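(* Let $n\ge 3$ and $\Gamma_n=\mathrm{SL}(n,\mathbb{Z})$. The orbit-stabilizer problem is solvable for finite index subgroups of $\Gamma_n$ acting on $\mathbb{Q}^n$. That is, there are algorithms which, given a finite set $S\subseteq\Gamma_n$ generating a subgroup $H=\langle S\rangle$ of finite index in $\Gamma_n$, and given $u,v\in\mathbb{Q}^n$: (I) decide whether there is $g\in H$ such that $gu=v$, and find such a $g$ if it exists, written as a word over $S\cup S^{-1}$; (II) determine $\mathrm{Stab}_H(u)=\{g\in H : gu=u\}$, by returning a finite generating set of $\mathrm{Stab}_H(u)$ whose elements are written as words over $S\cup S^{-1}$.
   Context: Vectors in $\mathbb{Q}^n$ are column vectors, on which matrices act by left multiplication. The index of $H$ in $\Gamma_n$ is promised to be finite. *)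

(* Defs.v *)
From mathcomp Require Import all_boot all_order all_algebra.
From Stdlib Require Cantor.

Set Implicit Arguments.
Unset Strict Implicit.
Unset Printing Implicit Defensive.

Import GRing.Theory.
Local Open Scope ring_scope.

(** * Algorithms: partial recursive functions

    "There is an algorithm" means "there is a partial recursive function".
    These are presented as programs computing partial functions [nat -> nat];
    several arguments are passed through Cantor's bijective pairing. *)

Definition cpair (a b : nat) : nat := Cantor.to_nat (a, b).

Inductive prog : Type :=
| Zero | Succ | Left | Right
| Pair of prog & prog
| Comp of prog & prog
| Prec of prog & prog
| Mu of prog.

(** [eval c x y]: the program [c] halts on input [x] with output [y].
    [Prec f g] is primitive recursion on the second component of the input,
    [Mu f] maps [a] to the least [m] with [f (a, m) = 0], and diverges if there
    is none or if [f (a, i)] diverges for some smaller [i]. *)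
Inductive eval : prog -> nat -> nat -> Prop :=
| EvalZero x : eval Zero x 0
| EvalSucc x : eval Succ x x.+1
| EvalLeft a b : eval Left (cpair a b) a
| EvalRight a b : eval Right (cpair a b) b
| EvalPair f g x y z :
    eval f x y -> eval g x z -> eval (Pair f g) x (cpair y z)
| EvalComp f g x y z :
    eval g x y -> eval f y z -> eval (Comp f g) x z
| EvalPrec0 f g a y :
    eval f a y -> eval (Prec f g) (cpair a 0) y
| EvalPrecS f g a m y z :
    eval (Prec f g) (cpair a m) y -> eval g (cpair a (cpair m y)) z ->
    eval (Prec f g) (cpair a m.+1) z
| EvalMu f a m (h : nat -> nat) :
    (forall i, (i < m)%N -> eval f (cpair a i) (h i).+1) ->
    eval f (cpair a m) 0 -> eval (Mu f) a m.

(** * Encoding of the inputs and outputs as natural numbers *)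

Definition enc_int (z : int) : nat :=
  match z with Posz k => cpair 0 k | Negz k => cpair 1 k end.

Definition enc_rat (r : rat) : nat := cpair (enc_int (numq r)) (enc_int (denq r)).

Definition enc_seq (T : Type) (e : T -> nat) (s : seq T) : nat :=
  foldr (fun x c => (cpair (e x) c).+1) 0%N s.

Definition enc_option (T : Type) (e : T -> nat) (o : option T) : nat :=
  if o is Some x then (e x).+1 else 0%N.

(** A matrix is encoded as the list of its rows. *)
Definition enc_mx {T : Type} (e : T -> nat) {m n : nat} (A : 'M[T]_(m, n)) : nat :=
  enc_seq (enc_seq e) [seq [seq A i j | j <- enum 'I_n] | i <- enum 'I_m].

Section Groups.

Variable n : nat.
Implicit Types (S : seq 'M[int]_n) (w : seq 'M[int]_n) (g : 'M[int]_n).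
Implicit Types (u : 'cV[rat]_n).

(** * Subgroups of SL(n, Z) *)

Definition SLZ g : Prop := \det g = 1.

Inductive generated S : 'M[int]_n -> Prop :=
| Gen1 : generated S 1%:M
| GenMem g : g \in S -> generated S g
| GenMul g h : generated S g -> generated S h -> generated S (g *m h)
| GenInv g : generated S g -> generated S (invmx g).

(** The finitely many members of [T] represent all left cosets of [<S>]. *)
Definition finite_index S : Prop :=
  exists2 T : seq 'M[int]_n, {in T, forall t, SLZ t} &
    forall g, SLZ g -> exists t h, [/\ t \in T, generated S h & g = t *m h].

Definition act g u : 'cV[rat]_n := map_mx intr g *m u.

Definition stab S u g : Prop := generated S g /\ act g u = u.

(** A word over [S] and its inverses is the list of its letters. *)
Definition is_word S w : Prop := {subset w <= S ++ [seq invmx s | s <- S]}.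

Definition word_val w : 'M[int]_n := foldr mulmx 1%:M w.

End Groups.

Definition enc_word {n : nat} (w : seq 'M[int]_n) : nat :=
  enc_seq (enc_mx enc_int) w.

Definition enc_vec {n : nat} (u : 'cV[rat]_n) : nat := enc_mx enc_rat u.

(* Main.v *)
Require Import Defs.
From HB Require Import structures.
From mathcomp Require Import all_boot all_order all_algebra.
From mathcomp Require Import zify ring.
From mathcomp Require boolp.
From Stdlib Require Import Setoid Morphisms.
From Stdlib Require Cantor.

(** The subgroup H also has finite index in G = GL_n(Z), whose elements are written as
    words in elementary matrices, sign changes and transpositions.  Both algorithms search
    for a certificate that can be checked mechanically.

    Positive answers are certified by words.  Negative answers rest on a finite
    presentation of G: if permutations of a finite set satisfy the defining relations and
    the generators of H fix the point 0, then every word whose value lies in H fixes 0;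
    conversely, the action of G on G/H is such a permutation action in which the
    stabilizer of 0 is exactly H.  A rational vector is c * g e_0 with c >= 0 and g in G,
    and the stabilizer of e_0 in G is generated by finitely many letters.  Hence c g e_0 and
    c g' e_0 lie in different H-orbits if and only if the orbit of the point g^-1 0 under
    Stab(c e_0) misses g'^-1 0, and Stab_H(c g e_0) is obtained from Schreier generators.

    The presentation is proved by induction on the set of indices that occur in the word.
    The subtractive Euclidean algorithm assigns to every nonzero vector a coset of the
    group generated by the letters fixing e_p.  The relations make this assignment
    independent of the order of the reduction steps, hence equivariant; so a word of
    value 1 equals a word in letters fixing e_p, that is a product of translations and of
    a word that avoids the index p. *)

Set Implicit Arguments.
Unset Strict Implicit.
Unset Printing Implicit Defensive.

Import Order.TTheory GRing.Theory Num.Theory.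


(** * Computable functions between encoded types *)

(** Every answer is found by an unbounded search, so no bound on the work has to be known: it is
    enough that a certificate which passes the test tells the truth, and that some certificate
    exists. Finite index enters through existence, where it provides the coset table. A table that
    passes need not be this coset table, as the stabilizer of 0 may be larger than H. The negative
    tests use it only to show that an element lies outside of H, and for this a larger stabilizer
    errs on the safe side.

    A table can be tested for finitely many equations between words, whereas membership in H
    concerns matrices; the presentation is the bridge. Passing from SL to GL at most doubles the
    index, and it lets signs and the order of coordinates be changed freely, so that the Euclidean
    algorithm can be studied on vectors of natural numbers. The crux is its confluence: disjoint
    steps commute, overlapping steps differ by a Steinberg commutator, and two equal entries, either
    of which can annihilate the other, call for the rank two relation. *)

HB.mixin Record isEncoded (T : Type) := {
  code : T -> nat;
  code_inj : injective code }.

#[short(type="encType")]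
HB.structure Definition Encoded := {T of isEncoded T & Equality T}.

Arguments cpair : simpl never.

Lemma cpair_inj a b c d : cpair a b = cpair c d -> a = c /\ b = d.
Proof.
by rewrite /cpair => /(congr1 Cantor.of_nat); rewrite !Cantor.cancel_of_to => -[].
Qed.

Lemma cpair_surj m : exists a b, m = cpair a b.
Proof.
by exists (Cantor.of_nat m).1, (Cantor.of_nat m).2;
  rewrite /cpair -surjective_pairing Cantor.cancel_to_of.
Qed.

Lemma leq_cpair2 a b : b <= cpair a b.
Proof. by have := Cantor.to_nat_non_decreasing a b; rewrite /cpair; lia. Qed.

HB.instance Definition _ := isEncoded.Build nat (@inj_id nat).

Fact nat_of_bool_inj : injective nat_of_bool.
Proof. by case=> -[]. Qed.
HB.instance Definition _ := isEncoded.Build bool nat_of_bool_inj.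

Definition code_pair (A B : encType) (q : A * B) := cpair (code q.1) (code q.2).

Fact code_pair_inj (A B : encType) : injective (@code_pair A B).
Proof.
by move=> [a b] [c d]; rewrite /code_pair /= => /cpair_inj[/code_inj-> /code_inj->].
Qed.
HB.instance Definition _ (A B : encType) :=
  isEncoded.Build (A * B)%type (@code_pair_inj A B).

Fact enc_seq_inj (A : encType) : injective (enc_seq (@code A)).
Proof.
elim=> [|x s IHs] [|y t] //= [].
by move=> /cpair_inj[/code_inj-> /IHs->].
Qed.
HB.instance Definition _ (A : encType) := isEncoded.Build (seq A) (@enc_seq_inj A).

Fact enc_option_inj (A : encType) : injective (enc_option (@code A)).
Proof. by move=> [x|] [y|] //= [/code_inj->]. Qed.
HB.instance Definition _ (A : encType) :=
  isEncoded.Build (option A) (@enc_option_inj A).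

Fact enc_int_inj : injective enc_int.
Proof. by move=> [m|m] [k|k] /cpair_inj[] // _ ->. Qed.
HB.instance Definition _ := isEncoded.Build int enc_int_inj.

Fact enc_rat_inj : injective enc_rat.
Proof.
move=> x y /cpair_inj[/enc_int_inj nE /enc_int_inj dE].
by rewrite -(divq_num_den x) nE dE divq_num_den.
Qed.
HB.instance Definition _ := isEncoded.Build rat enc_rat_inj.

(** The program is constrained only on codes of elements of [A]; on other numbers it may diverge or
    return anything. *)
Definition computable (A B : encType) (f : A -> B) :=
  exists p, forall x, eval p (code x) (code (f x)).


(** * Closure under composition, recursion and case distinction *)

Section Basic.
Implicit Types A B C D : encType.

Lemma eval_id m : eval (Pair Left Right) m m.
Proof.
have [a [b ->]] := cpair_surj m.
by apply: EvalPair; [apply: EvalLeft | apply: EvalRight].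
Qed.

Lemma computable_id A : computable (fun x : A => x).
Proof. by exists (Pair Left Right) => x; apply: eval_id. Qed.

Lemma computable_comp A B C (g : B -> C) (f : A -> B) :
  computable g -> computable f -> computable (fun x => g (f x)).
Proof.
move=> [p Hp] [q Hq]; exists (Comp p q) => x.
by apply: EvalComp (Hq x) (Hp _).
Qed.

Lemma computable_ext A B (f g : A -> B) : f =1 g -> computable f -> computable g.
Proof. by move=> fg [p Hp]; exists p => x; rewrite -fg. Qed.

Fixpoint const_prog m := if m is k.+1 then Comp Succ (const_prog k) else Zero.

Lemma computable_cst A B (y : B) : computable (fun _ : A => y).
Proof.
exists (const_prog (code y)) => x; elim: (code y) => [|m IHm] /=; first exact: EvalZero.
by apply: EvalComp IHm _; apply: EvalSucc.
Qed.

Lemma computable_pair A B C (f : A -> B) (g : A -> C) :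
  computable f -> computable g -> computable (fun x => (f x, g x)).
Proof.
by move=> [p Hp] [q Hq]; exists (Pair p q) => x; apply: EvalPair.
Qed.

Lemma computable_fst A B C (f : A -> B * C) :
  computable f -> computable (fun x => (f x).1).
Proof.
apply: computable_comp; exists Left => -[b c]; exact: EvalLeft.
Qed.

Lemma computable_snd A B C (f : A -> B * C) :
  computable f -> computable (fun x => (f x).2).
Proof.
apply: computable_comp; exists Right => -[b c]; exact: EvalRight.
Qed.

Lemma computable_succ A (f : A -> nat) :
  computable f -> computable (fun x => (f x).+1).
Proof. by apply: computable_comp; exists Succ => m; apply: EvalSucc. Qed.

Lemma computable_code A B (f : A -> B) :
  computable f -> computable (fun x => code (f x)).
Proof. by move=> [p Hp]; exists p. Qed.

Lemma computable_Some A B (f : A -> B) :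
  computable f -> computable (fun x => Some (f x)).
Proof. by move=> [p Hp]; exists (Comp Succ p) => x; apply: EvalComp (Hp x) (EvalSucc _). Qed.

Lemma computable_nat_rec A B (b : A -> B) (h : A -> nat -> B -> B) (f : A -> nat) :
  computable b -> computable (fun q : A * (nat * B) => h q.1 q.2.1 q.2.2) ->
  computable f -> computable (fun x => iteri (f x) (h x) (b x)).
Proof.
move=> [p Hp] [q Hq] cf.
apply: (@computable_comp _ _ _ (fun q : A * nat => iteri q.2 (h q.1) (b q.1))
  (fun x => (x, f x))); last first.
  by apply: computable_pair => //; apply: computable_id.
exists (Prec p q) => -[x m] /=; rewrite /code /= /code_pair /=.
elim: m => [|m IHm] /=; first exact/EvalPrec0/Hp.
by apply: EvalPrecS IHm _; apply: (Hq (x, (m, _))).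
Qed.

(** The truth value, encoded as 0 or 1, is the recursion bound of [Prec]. The recursion starts with
    [g] in both cases, which is harmless because [f] and [g] are total. *)
Lemma computable_if A B (c : A -> bool) (f g : A -> B) :
  computable c -> computable f -> computable g ->
  computable (fun x => if c x then f x else g x).
Proof.
move=> [pc Hc] [pf Hf] [pg Hg].
exists (Comp (Prec pg (Comp pf Left)) (Pair (Pair Left Right) pc)) => x.
apply: EvalComp.
  by apply: EvalPair (Hc x); apply: eval_id.
have H0 : eval (Prec pg (Comp pf Left)) (cpair (code x) 0) (code (g x)).
  exact/EvalPrec0/Hg.
case: (c x) => //; apply: EvalPrecS H0 _.
by apply: EvalComp (Hf x); apply: EvalLeft.
Qed.

Lemma computable_pred A (f : A -> nat) :
  computable f -> computable (fun x => (f x).-1).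
Proof.
move=> cf; apply: (@computable_ext _ _ (fun x => iteri (f x) (fun m _ => m) 0)).
  by move=> x; case: (f x).
apply: computable_nat_rec => //; first exact: computable_cst.
by apply/computable_fst/computable_snd/computable_id.
Qed.

Lemma computable_add A (f g : A -> nat) :
  computable f -> computable g -> computable (fun x => f x + g x).
Proof.
move=> cf cg; apply: (@computable_ext _ _ (fun x => iteri (f x) (fun _ m => m.+1) (g x))).
  by move=> x; elim: (f x) => //= m ->.
apply: computable_nat_rec => //.
by apply/computable_succ/computable_snd/computable_snd/computable_id.
Qed.

Lemma computable_mul A (f g : A -> nat) :
  computable f -> computable g -> computable (fun x => f x * g x).
Proof.
move=> cf cg.
apply: (@computable_ext _ _ (fun x => iteri (f x) (fun _ m => g x + m) 0)).
  by move=> x; elim: (f x) => //= m ->; rewrite mulSn.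
apply: computable_nat_rec => //; first exact: computable_cst.
apply: computable_add; last by apply/computable_snd/computable_snd/computable_id.
by apply: (computable_comp cg); apply/computable_fst/computable_id.
Qed.

Lemma computable_sub A (f g : A -> nat) :
  computable f -> computable g -> computable (fun x => f x - g x).
Proof.
move=> cf cg.
apply: (@computable_ext _ _ (fun x => iteri (g x) (fun _ m => m.-1) (f x))).
  by move=> x; elim: (g x) => [|m /= ->]; rewrite ?subn0 ?subnS.
apply: computable_nat_rec => //.
by apply/computable_pred/computable_snd/computable_snd/computable_id.
Qed.

Lemma computable_eq0 A (f : A -> nat) :
  computable f -> computable (fun x => f x == 0).
Proof.
move=> cf.
apply: (@computable_ext _ _ (fun x => iteri (f x) (fun _ _ => false) true)).
  by move=> x; case: (f x).
by apply: computable_nat_rec => //; apply: computable_cst.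
Qed.

Lemma computable_leq A (f g : A -> nat) :
  computable f -> computable g -> computable (fun x => f x <= g x).
Proof. by move=> cf cg; apply/computable_eq0/computable_sub. Qed.

Lemma computable_neg A (b : A -> bool) :
  computable b -> computable (fun x => ~~ b x).
Proof. by move=> cb; apply: computable_if => //; apply: computable_cst. Qed.

Lemma computable_and A (b c : A -> bool) :
  computable b -> computable c -> computable (fun x => b x && c x).
Proof. by move=> cb cc; apply: computable_if => //; apply: computable_cst. Qed.

Lemma computable_or A (b c : A -> bool) :
  computable b -> computable c -> computable (fun x => b x || c x).
Proof. by move=> cb cc; apply: computable_if => //; apply: computable_cst. Qed.

Lemma computable_eq A B (f g : A -> B) :
  computable f -> computable g -> computable (fun x => f x == g x).
Proof.
move=> cf cg.
apply: (@computable_ext _ _ (fun x => (code (f x) - code (g x)) + (code (g x) - code (f x)) == 0)).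
  by move=> x; rewrite -(inj_eq (@code_inj B)); lia.
by apply/computable_eq0/computable_add; apply: computable_sub; apply: computable_code.
Qed.

(* [Prec] is strict in the recursive call, so the case split first computes the
   predecessor and then branches on a 0/1 flag: this way [g] is only run on
   genuine codes. *)
Lemma computable_case_seq A B C (f : A -> C) (g : A -> B -> seq B -> C) (l : A -> seq B) :
  computable f -> computable (fun q : A * (B * seq B) => g q.1 q.2.1 q.2.2) ->
  computable l -> computable (fun x => if l x is h :: t then g x h t else f x).
Proof.
move=> [pf Hf] [pg Hg] cl.
have [p Hp] : computable (fun x => (x, (code (l x)).-1)).
  apply: computable_pair; first exact: computable_id.
  exact/computable_pred/computable_code.
have [s Hs] : computable (fun x => code (l x) != 0).
  exact/computable_neg/computable_eq0/computable_code.
exists (Comp (Prec (Comp pf Left) (Comp pg Left)) (Pair p s)) => x.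
apply: EvalComp.
  by apply: EvalPair; [apply: Hp | apply: Hs].
rewrite {1}/code /= /code_pair /=.
have H0 m : eval (Prec (Comp pf Left) (Comp pg Left)) (cpair (cpair (code x) m) 0)
   (code (f x)).
  by apply: EvalPrec0; apply: EvalComp (Hf x); apply: EvalLeft.
case: (l x) => [|h t]; first exact: H0.
apply: EvalPrecS (H0 _) _; apply: EvalComp; first exact: EvalLeft.
exact: (Hg (x, (h, t))).
Qed.

End Basic.

Ltac comp_core := repeat (cbv beta; try assumption; lazymatch goal with
  | |- computable (fun x => x) => apply: computable_id
  | |- computable (fun _ => ?c) => apply: (computable_cst _ c)
  | |- computable fst => apply: (computable_fst (computable_id _))
  | |- computable snd => apply: (computable_snd (computable_id _))
  | |- computable (fun x => fst _) => apply: computable_fst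
  | |- computable (fun x => snd _) => apply: computable_snd
  | |- computable (fun x => pair _ _) => apply: computable_pair
  | |- computable (fun x => S _) => apply: computable_succ
  | |- computable (fun x => code _) => apply: computable_code
  | |- computable (fun x => predn _) => apply: computable_pred
  | |- computable (fun x => addn _ _) => apply: computable_add
  | |- computable (fun x => muln _ _) => apply: computable_mul
  | |- computable (fun x => subn _ _) => apply: computable_sub
  | |- computable (fun x => leq _ _) => apply: computable_leq
  | |- computable (fun x => andb _ _) => apply: computable_and
  | |- computable (fun x => orb _ _) => apply: computable_or
  | |- computable (fun x => negb _) => apply: computable_neg
  | |- computable (fun x => if _ then _ else _) => apply: computable_if
  | |- computable (fun x => eq_op _ _) => apply: computable_eq
  end).

(** * Computability of list operations *)

Section Lists.
Implicit Types A B C : encType.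

Lemma computable_cons A B (f : A -> B) (g : A -> seq B) :
  computable f -> computable g -> computable (fun x => f x :: g x).
Proof.
move=> cf cg; have [p Hp] := computable_pair cf cg.
by exists (Comp Succ p) => x; apply: EvalComp (Hp x) (EvalSucc _).
Qed.

Lemma size_leq_code A (l : seq A) : size l <= code l.
Proof.
elim: l => //= x l IHl; rewrite /code /= ltnS.
by apply: leq_trans IHl (leq_cpair2 _ _).
Qed.

(** The state holds the unread part of the list and the accumulator. It is iterated [code (l x)]
    times: this number is at hand and bounds the length, and a state with nothing left to read no
    longer changes. *)
Lemma computable_foldl A B C (f : A -> B -> C -> B) (z : A -> B) (l : A -> seq C) :
  computable (fun q : A * (B * C) => f q.1 q.2.1 q.2.2) ->
  computable z -> computable l -> computable (fun x => foldl (f x) (z x) (l x)).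
Proof.
move=> cf cz cl.
pose step (x : A) (_ : nat) (st : seq C * B) : seq C * B :=
  if st.1 is h :: t then (t, f x st.2 h) else ([::], st.2).
apply: (@computable_ext _ _
  (fun x => (iteri (code (l x)) (step x) (l x, z x)).2)) => [x|].
  have : size (l x) <= code (l x) by apply: size_leq_code.
  suff E m s a : size s <= m -> (iteri m (step x) (s, a)) = ([::], foldl (f x) a s).
    by move=> /E->.
  have iteriSr k u : iteri k.+1 (step x) u = iteri k (step x) (step x 0 u).
    by elim: k => //= k ->.
  elim: m s a => [|m IHm] [|h t] a // sm; rewrite iteriSr ?IHm //.
apply: computable_snd; apply: computable_nat_rec; comp_core.

apply: (@computable_case_seq _ _ _ (fun q => ([::], q.2.2.2))
  (fun q h t => (t, f q.1 q.2.2.2 h)) (fun q => q.2.2.1)); comp_core.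
apply: (@computable_comp _ _ _ _ (fun q => (q.1.1, (q.1.2.2.2, q.2.1))) cf).
comp_core.
Qed.

Lemma computable_rev A B (l : A -> seq B) :
  computable l -> computable (fun x => rev (l x)).
Proof.
move=> cl; apply: (@computable_ext _ _ (fun x => foldl (fun s y => y :: s) [::] (l x))).
  move=> x; rewrite /rev; move: [::]; by elim: (l x) => //= h t IHt s; rewrite IHt.
by apply: computable_foldl; comp_core; apply: computable_cons; comp_core.
Qed.

Lemma computable_foldr A B C (f : A -> C -> B -> B) (z : A -> B) (l : A -> seq C) :
  computable (fun q : A * (C * B) => f q.1 q.2.1 q.2.2) ->
  computable z -> computable l -> computable (fun x => foldr (f x) (z x) (l x)).
Proof.
move=> cf cz cl.
apply: (@computable_ext _ _ (fun x => foldl (fun b c => f x c b) (z x) (rev (l x)))).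
  by move=> x; rewrite -foldl_rev.
apply: computable_foldl => //; last exact: computable_rev.
apply: (@computable_comp _ _ _ _ (fun q => (q.1, (q.2.2, q.2.1))) cf); comp_core.
Qed.

Lemma computable_map A B C (f : A -> C -> B) (l : A -> seq C) :
  computable (fun q : A * C => f q.1 q.2) -> computable l ->
  computable (fun x => [seq f x y | y <- l x]).
Proof.
move=> cf cl.
apply: (@computable_ext _ _ (fun x => foldr (fun y s => f x y :: s) [::] (l x))) => //.
apply: computable_foldr; comp_core; apply: computable_cons; comp_core.
by apply: (@computable_comp _ _ _ _ (fun q => (q.1, q.2.1)) cf); comp_core.
Qed.

Lemma computable_all A C (b : A -> C -> bool) (l : A -> seq C) :
  computable (fun q : A * C => b q.1 q.2) -> computable l ->
  computable (fun x => all (b x) (l x)).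
Proof.
move=> cb cl.
apply: (@computable_ext _ _ (fun x => foldr (fun y s => b x y && s) true (l x))) => //.
apply: computable_foldr; comp_core.
by apply: (@computable_comp _ _ _ _ (fun q => (q.1, q.2.1)) cb); comp_core.
Qed.

Lemma computable_has A C (b : A -> C -> bool) (l : A -> seq C) :
  computable (fun q : A * C => b q.1 q.2) -> computable l ->
  computable (fun x => has (b x) (l x)).
Proof.
move=> cb cl.
apply: (@computable_ext _ _ (fun x => foldr (fun y s => b x y || s) false (l x))) => //.
apply: computable_foldr; comp_core.
by apply: (@computable_comp _ _ _ _ (fun q => (q.1, q.2.1)) cb); comp_core.
Qed.

Lemma computable_mem A C (y : A -> C) (l : A -> seq C) :
  computable y -> computable l -> computable (fun x => y x \in l x).
Proof.
move=> cy cl; apply: (@computable_ext _ _ (fun x => has (fun z => z == y x) (l x))).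
  by move=> x; rewrite -has_pred1.
apply: computable_has; comp_core.
by apply: (computable_comp cy); comp_core.
Qed.

Lemma computable_cat A B (f g : A -> seq B) :
  computable f -> computable g -> computable (fun x => f x ++ g x).
Proof.
move=> cf cg.
apply: (@computable_ext _ _ (fun x => foldr cons (g x) (f x))).
  by move=> x; by elim: (f x) => //= y s <-.
apply: computable_foldr; comp_core; apply: computable_cons; comp_core.
Qed.

Lemma computable_flatten A B (f : A -> seq (seq B)) :
  computable f -> computable (fun x => flatten (f x)).
Proof.
by move=> cf; apply: computable_foldr; comp_core; apply: computable_cat; comp_core.
Qed.

Lemma computable_size A B (f : A -> seq B) :
  computable f -> computable (fun x => size (f x)).
Proof.
move=> cf; apply: (@computable_ext _ _ (fun x => foldr (fun _ m => m.+1) 0 (f x))) => //.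
by apply: computable_foldr; comp_core.
Qed.

Lemma computable_nth A B (d : B) (s : A -> seq B) (i : A -> nat) :
  computable s -> computable i -> computable (fun x => nth d (s x) (i x)).
Proof.
move=> cs ci.
apply: (@computable_ext _ _
  (fun x => head d (iteri (i x) (fun _ t => behead t) (s x)))) => [x|].
  rewrite -(addn0 (i x)) -nth_drop nth0; congr head.
  by elim: (i x) => [|m /= ->]; rewrite ?drop0 // -add1n -drop_drop drop1.
apply: (@computable_case_seq _ _ _ (fun=> d) (fun _ h _ => h)); comp_core.
apply: computable_nat_rec; comp_core.
by apply: (@computable_case_seq _ _ _ (fun=> [::]) (fun _ _ t => t)); comp_core.
Qed.

End Lists.

(** * Integers and rational numbers *)

Section Integers.
Variable A : encType.

Lemma computable_Posz (f : A -> nat) : computable f -> computable (fun x => Posz (f x)).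
Proof. by move=> /(computable_pair (computable_cst A 0))[p Hp]; exists p. Qed.

Lemma computable_Negz (f : A -> nat) : computable f -> computable (fun x => Negz (f x)).
Proof. by move=> /(computable_pair (computable_cst A 1))[p Hp]; exists p. Qed.

Lemma computable_case_int (B : encType) (f g : A -> nat -> B) (z : A -> int) :
  computable (fun q : A * nat => f q.1 q.2) -> computable (fun q : A * nat => g q.1 q.2) ->
  computable z ->
  computable (fun x => match z x with Posz m => f x m | Negz m => g x m end).
Proof.
move=> cf cg [p Hp].
pose sg (x : A) := if z x is Posz _ then 0 else 1.
pose ab (x : A) := match z x with Posz m => m | Negz m => m end.
have csg : computable sg.
  by exists (Comp Left p) => x; apply: EvalComp (Hp x) _; rewrite /sg; case: (z x) => m;
     apply: EvalLeft.
have cab : computable ab.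
  by exists (Comp Right p) => x; apply: EvalComp (Hp x) _; rewrite /ab; case: (z x) => m;
     apply: EvalRight.
apply: (@computable_ext _ _ (fun x => if sg x == 0 then f x (ab x) else g x (ab x))).
  by move=> x; rewrite /sg /ab; case: (z x).
apply: computable_if; comp_core.
  by apply: (@computable_comp _ _ _ _ (fun x => (x, ab x)) cf); comp_core.
by apply: (@computable_comp _ _ _ _ (fun x => (x, ab x)) cg); comp_core.
Qed.

End Integers.

Section IntegerOperations.
Variable A : encType.
Implicit Types f g : A -> int.
Local Open Scope ring_scope.

Lemma computable_opp f : computable f -> computable (fun x => - f x).
Proof.
move=> cf.
apply: (@computable_ext _ _ (fun x => match f x with
   | Posz m => if (m == 0)%N then Posz 0 else Negz m.-1
   | Negz m => Posz m.+1 end)).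
  by move=> x; case: (f x) => [[|m]|m].
apply: (@computable_case_int _ _ (fun _ m => if (m == 0)%N then Posz 0 else Negz m.-1)
   (fun _ m => Posz m.+1)); comp_core.
  by apply: computable_Negz; comp_core.
by apply: computable_Posz; comp_core.
Qed.

Lemma computable_subz (B : encType) (f g : B -> nat) : computable f -> computable g ->
  computable (fun x => (f x)%:Z - (g x)%:Z).
Proof.
move=> cf cg.
apply: (@computable_ext _ _ (fun x => if (g x <= f x)%N then Posz (f x - g x)
   else Negz (g x - f x).-1)).
  by move=> x; case: leqP; lia.
by apply: computable_if; comp_core; [apply: computable_Posz | apply: computable_Negz]; comp_core.
Qed.

Lemma computable_addz f g : computable f -> computable g ->
  computable (fun x => f x + g x).
Proof.
move=> cf cg.
pose pos z := if z is Posz m then m else 0%N.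
pose neg z := if z is Negz m then m.+1 else 0%N.
have cpos (h : A -> int) : computable h -> computable (fun x => pos (h x)).
  by move=> ch; apply: (@computable_case_int _ _ (fun _ m => m) (fun _ _ => 0%N)); comp_core.
have cneg (h : A -> int) : computable h -> computable (fun x => neg (h x)).
  by move=> ch; apply: (@computable_case_int _ _ (fun _ _ => 0%N) (fun _ m => m.+1)); comp_core.
apply: (@computable_ext _ _
  (fun x => (pos (f x) + pos (g x))%N%:Z - (neg (f x) + neg (g x))%N%:Z)).
  by move=> x; rewrite /pos /neg; case: (f x) => a; case: (g x) => b; lia.
by apply: computable_subz; apply: computable_add; auto.
Qed.

Lemma computable_mulz f g : computable f -> computable g ->
  computable (fun x => f x * g x).
Proof.
move=> cf cg.
pose sg z := if z is Posz m then false else true.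
pose ab z := match z with Posz m => m | Negz m => m.+1 end.
have csg (h : A -> int) : computable h -> computable (fun x => sg (h x)).
  by move=> ch; apply: (@computable_case_int _ _ (fun _ m => false) (fun _ _ => true)); comp_core.
have cab (h : A -> int) : computable h -> computable (fun x => ab (h x)).
  by move=> ch; apply: (@computable_case_int _ _ (fun _ m => m) (fun _ m => m.+1)); comp_core.
apply: (@computable_ext _ _
  (fun x => if sg (f x) == sg (g x) then (ab (f x) * ab (g x))%N%:Z
            else - (ab (f x) * ab (g x))%N%:Z)).
  by move=> x; rewrite /sg /ab; case: (f x) => a; case: (g x) => b //=; lia.
apply: computable_if; [apply: computable_eq | | apply: computable_opp]; auto;
  by apply: computable_Posz; apply: computable_mul; auto.
Qed.

Lemma computable_numq (r : A -> rat) : computable r -> computable (fun x => numq (r x)).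
Proof.
by move=> [p Hp]; exists (Comp Left p) => x; apply: EvalComp (Hp x) (EvalLeft _ _).
Qed.

Lemma computable_denq (r : A -> rat) : computable r -> computable (fun x => denq (r x)).
Proof.
by move=> [p Hp]; exists (Comp Right p) => x; apply: EvalComp (Hp x) (EvalRight _ _).
Qed.

End IntegerOperations.

(** * Unbounded search *)

Definition surjective_code (C : encType) := forall m, exists c : C, code c = m.

Lemma surjective_code_nat : surjective_code nat.
Proof. by move=> m; exists m. Qed.

Lemma surjective_code_pair (A B : encType) :
  surjective_code A -> surjective_code B -> surjective_code (A * B)%type.
Proof.
move=> sA sB m; have [a [b ->]] := cpair_surj m.
by have [x <-] := sA a; have [y <-] := sB b; exists (x, y).
Qed.

Lemma surjective_code_seq (A : encType) : surjective_code A -> surjective_code (seq A).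
Proof.
move=> sA m; elim/ltn_ind: m => -[_|m IHm]; first by exists [::].
have [a [b E]] := cpair_surj m; have [x xE] := sA a.
have [|s sE] := IHm b; first by rewrite E ltnS leq_cpair2.
by exists (x :: s); rewrite /code /= -/(code s) -/(code x) xE sE -E.
Qed.

Lemma least_certificate (C : encType) (P : pred C) : surjective_code C ->
  (exists c, P c) -> exists c, P c /\ forall m, m < code c -> exists c', code c' = m /\ ~~ P c'.
Proof.
move=> sC [c0]; have [k] := ubnP (code c0); elim: k c0 => // k IHk c0 lk Pc0.
have [[c [lc Pc]]|no] := boolp.pselect (exists c, code c < code c0 /\ P c).
  by apply: IHk Pc; lia.
exists c0; split=> // m lm; have [c E] := sC m; exists c; split=> //.
by apply/negP => Pc; apply: no; exists c; rewrite E.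
Qed.

(* Only a certificate type all of whose codes are genuine can be searched: [Mu]
   diverges as soon as the test diverges on some smaller number. *)
Lemma certificate_search (A C : encType) (chk : A -> C -> bool) :
  surjective_code C -> computable (fun q : A * C => chk q.1 q.2) ->
  exists p, forall x, (exists c, chk x c) ->
    exists c, chk x c /\ eval p (code x) (code c).
Proof.
move=> sC /computable_neg[p Hp]; exists (Mu p) => x [c0 Hc0].
have [c [Pc low]] := least_certificate sC (ex_intro (fun c => chk x c) c0 Hc0).
exists c; split=> //; apply: (@EvalMu _ _ _ (fun=> 0)).
  by move=> i /low[c' [<- nP]]; have := Hp (x, c'); rewrite /= nP.
by have := Hp (x, c); rewrite /= Pc.
Qed.


(** * Words over elementary matrices, sign changes and transpositions *)

Definition letter n : Type := ((bool * 'I_n * 'I_n) + ('I_n + 'I_n * 'I_n))%type.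

Notation X b i j := (inl (b, i, j)).
Notation E i := (inr (inl i)).
Notation T i j := (inr (inr (i, j))).

Ltac case_indices :=
  repeat first
    [ done
    | match goal with H : is_true (negb (?x == ?x)) |- _ => by rewrite eqxx in H end
    | match goal with |- context [@eq_op _ ?x ?y] =>
        is_var x; is_var y; case: (eqVneq x y) => ? /= end; subst; rewrite ?eqxx ?mxE ?ffunE /= ].

Section Words.
Variable n : nat.
Local Notation letter := (letter n).
Local Notation word := (seq letter).
Implicit Types (a : letter) (w u : word) (i j k l : 'I_n) (b c : bool).
Local Open Scope ring_scope.

Definition swap i j k := if k == i then j else if k == j then i else k.

(* Row operations; [X b i i] is the identity, so that every letter is invertible. *)
Definition lact a m (M : 'M[int]_(n, m)) : 'M[int]_(n, m) :=
  match a with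
  | X b i j => \matrix_(r, c) (if (r == i) && (i != j) then
       (if b then M r c + M j c else M r c - M j c) else M r c)
  | E i => \matrix_(r, c) (if r == i then - M r c else M r c)
  | T i j => \matrix_(r, c) M (swap i j r) c
  end.

Definition wact w m (M : 'M[int]_(n, m)) := foldr (fun a => @lact a m) M w.
Definition wval w : 'M[int]_n := wact w 1%:M.

Definition linv a : letter := if a is X b i j then X (~~ b) i j else a.
Definition winv w : word := rev (map linv w).

Lemma wact_cat w u m (M : 'M_(n, m)) : wact (w ++ u) M = wact w (wact u M).
Proof. by rewrite /wact foldr_cat. Qed.

Lemma lactM a m q (M : 'M_(n, m)) (N : 'M_(m, q)) : lact a (M *m N) = lact a M *m N.
Proof.
case: a => [[[b i] j]|[i|[i j]]]; apply/matrixP => r c; rewrite !mxE.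
- case: ifP => [H|H].
    case: b; rewrite ?mxE -?sumrB -?big_split; apply: eq_bigr => s _;
      by rewrite !mxE H ?mulrDl ?mulrBl ?mulNr.
  by apply: eq_bigr => s _; rewrite !mxE H.
- case: ifP => [H|H]; rewrite ?mxE -?sumrN; apply: eq_bigr => s _;
  by rewrite !mxE H ?mulNr.
- by apply: eq_bigr => s _; rewrite !mxE.
Qed.

Lemma wactM w m q (M : 'M_(n, m)) (N : 'M_(m, q)) : wact w (M *m N) = wact w M *m N.
Proof. by elim: w => //= a w; rewrite /wact /= => ->; rewrite lactM. Qed.

Lemma wactE w m (M : 'M_(n, m)) : wact w M = wval w *m M.
Proof. by rewrite -wactM mul1mx. Qed.

Lemma val_cat w u : wval (w ++ u) = wval w *m wval u.
Proof. by rewrite -wactE /wval -wact_cat. Qed.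

Lemma val_cons a w : wval (a :: w) = lact a (wval w).
Proof. by []. Qed.

Lemma swapK i j : involutive (swap i j).
Proof.
move=> k; rewrite /swap.
by case_indices.
Qed.

Lemma linvK a : linv (linv a) = a.
Proof. by case: a => [[[b i] j]|a] //=; rewrite negbK. Qed.

Lemma winvK w : winv (winv w) = w.
Proof. by rewrite /winv map_rev revK (mapK linvK). Qed.

Lemma winv_cat w u : winv (w ++ u) = winv u ++ winv w.
Proof. by rewrite /winv map_cat rev_cat. Qed.

Lemma lact_inv a m (M : 'M_(n, m)) : lact (linv a) (lact a M) = M.
Proof.
case: a => [[[b i] j]|[i|[i j]]]; apply/matrixP => r c; rewrite !mxE ?swapK //.
  by case: b => /=; case_indices; rewrite ?subrK ?addrK.
by case: eqVneq => // _; rewrite opprK.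
Qed.

Lemma val_winvl w : wval (winv w) *m wval w = 1%:M.
Proof.
elim: w => [|a w IHw]; first by rewrite mul1mx.
rewrite -[a :: w]cat1s winv_cat !val_cat -mulmxA (mulmxA (wval (winv [:: a]))).
by rewrite -(wactE (winv [:: a])) /winv /= /rev /= lact_inv mul1mx.
Qed.

Lemma val_winvr w : wval w *m wval (winv w) = 1%:M.
Proof. by rewrite -{1}(winvK w) val_winvl. Qed.

Lemma val_unit w : wval w \in unitmx.
Proof. by have [] := mulmx1_unit (val_winvr w). Qed.

Lemma val_winv w : wval (winv w) = invmx (wval w).
Proof.
by rewrite -[LHS]mulmx1 -(mulmxV (val_unit w)) mulmxA val_winvl mul1mx.
Qed.

(** * A finite presentation of the unimodular group *)

(* Four letters are enough for the Steinberg relations, for those involving signs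
   and transpositions, and for the single relation [relator_braid] that
   is special to rank two. *)
Definition relator (l r : word) := [&& size l <= 4, size r <= 4 & wval l == wval r]%N.

Fixpoint words (m : nat) : seq word :=
  if m is m'.+1 then [::] :: [seq a :: w | a <- enum {: letter}, w <- words m']
  else [:: [::]].

Lemma mem_words w m : (size w <= m)%N -> w \in words m.
Proof.
elim: m w => [|m IHm] [|a w] //= /IHm Hw.
by rewrite inE; apply/orP; right; apply/allpairsP; exists (a, w); rewrite mem_enum.
Qed.

(** Every true equation between words of length at most four is taken, instead of the named families
    that follow: the list is finite, depends on [n] only, is sound by construction, and a family
    belongs to it as soon as it holds for matrices. *)
Definition relators : seq (word * word) :=
  [seq q <- [seq (u, w) | u <- words 4, w <- words 4] | wval q.1 == wval q.2].

Lemma mem_relators u w : relator u w -> (u, w) \in relators.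
Proof.
case/and3P => su sw e; rewrite mem_filter e; apply/andP; split=> //.
by apply/allpairsP; exists (u, w); rewrite !mem_words.
Qed.

Lemma relators_wval u w : (u, w) \in relators -> wval u = wval w.
Proof. by rewrite mem_filter => /andP[/eqP]. Qed.

Lemma relatorP u w : (size u <= 4)%N -> (size w <= 4)%N ->
  (forall M : 'M[int]_n, wact u M = wact w M) -> relator u w.
Proof. by move=> su sw H; apply/and3P; split=> //; apply/eqP/H. Qed.

End Words.

(** A relation is checked by its effect on the rows of an arbitrary matrix: once it is decided which
    indices coincide, each entry gives an identity of commutative rings. *)
Ltac check_relator :=
  apply: relatorP => // M; apply/matrixP => r0 c0; rewrite /= !mxE /= ?mxE /= /swap;
  case_indices; try ring.

Section Rels.
Variable n : nat.
Implicit Types (i j k l : 'I_n) (b c : bool).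

Lemma relator_XX b i j : @relator n [:: X (~~ b) i j; X b i j] [::].
Proof. case: b; check_relator. Qed.
Lemma relator_Xid b i : @relator n [:: X b i i] [::].
Proof. check_relator. Qed.
Lemma relator_EE i : @relator n [:: E i; E i] [::].
Proof. check_relator. Qed.
Lemma relator_ET i j : @relator n [:: E i; E j] [:: E j; E i].
Proof. check_relator. Qed.
Lemma relator_TT i j : @relator n [:: T i j; T i j] [::].
Proof. check_relator. Qed.
Lemma relator_Tid i : @relator n [:: T i i] [::].
Proof. check_relator. Qed.
Lemma relator_Tsym i j : @relator n [:: T i j] [:: T j i].
Proof. check_relator. Qed.
Lemma relator_XXc b c i j k l : j != k -> i != l ->
  @relator n [:: X b i j; X c k l] [:: X c k l; X b i j].
Proof. move=> jk il; case: b; case: c; check_relator. Qed.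
Lemma relator_XXX b c i j l : i != j -> j != l -> i != l ->
  @relator n [:: X b i j; X c j l] [:: X (b == c) i l; X c j l; X b i j].
Proof. move=> ij jl il; case: b; case: c; check_relator. Qed.
Lemma relator_EX b i j k :
  @relator n [:: E k; X b i j] [:: X (b (+) (k == i) (+) (k == j)) i j; E k].
Proof. case: b; check_relator. Qed.
Lemma relator_TX b i j k l :
  @relator n [:: T i j; X b k l] [:: X b (swap i j k) (swap i j l); T i j].
Proof. case: b; check_relator. Qed.
Lemma relator_TE i j k : @relator n [:: T i j; E k] [:: E (swap i j k); T i j].
Proof. check_relator. Qed.
Lemma relator_TTc i j k l :
  @relator n [:: T i j; T k l] [:: T (swap i j k) (swap i j l); T i j].
Proof. check_relator. Qed.
(** Since [X true j i] passes [T i j] as [X true i j], this amounts to x^-1 y x^-1 = E_i T_ij with x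
    and y the elementary matrices at (i, j) and (j, i): the Weyl element of the rank two subgroup is
    a signed transposition. *)
Lemma relator_braid i j : i != j ->
  @relator n [:: E i; X true j i; T i j] [:: X false i j; X true j i].
Proof. move=> ij; check_relator. Qed.
End Rels.

Ltac lia_numeric :=
  repeat match goal with
  | H : ?P |- _ =>
    lazymatch P with
    | is_true (leq _ _) => fail
    | is_true (Order.le _ _) => fail
    | is_true (Order.lt _ _) => fail
    | @eq nat _ _ => fail
    | @eq int _ _ => fail
    | _ => clear H
    end
  end; lia.

Definition letter_in n (J : {set 'I_n}) (a : letter n) : bool :=
  match a with
  | X _ i j => (i \in J) && (j \in J)
  | E i => i \in J
  | T i j => (i \in J) && (j \in J)
  end.

(** * Confluence of the subtractive Euclidean algorithm *)

Section Euclid.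
Variable n : nat.
Local Notation letter := (letter n).
Local Notation word := (seq letter).
(** The relation [eqw] will be equality of cosets of the group generated by letters that fix a basis
    vector e_p, and [base i] the coset of elements that carry e_p to e_i. The hypotheses on [base]
    record which letters fix such a coset and how transpositions permute these cosets. *)
Variables (J : {set 'I_n}) (eqw : word -> word -> Prop) (base : 'I_n -> word).
Context {eqw_equiv : Equivalence eqw}.
Context {eqw_cons : forall a, Proper (eqw ==> eqw) (cons a)}.
Local Notation "u ~ w" := (eqw u w) (at level 70).

Hypothesis eqw_rel : forall u w, relator u w -> forall t, u ++ t ~ w ++ t.
Hypothesis base_X : forall b i k l, i \in J -> k \in J -> l \in J -> l != i ->
  X b k l :: base i ~ base i.
Hypothesis base_E : forall i k, i \in J -> k \in J -> k != i -> (E k) :: base i ~ base i.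
Hypothesis base_T : forall i k l, i \in J -> k \in J -> l \in J ->
  T k l :: base i ~ base (swap k l i).

Implicit Types (f g : {ffun 'I_n -> nat}) (i j k l : 'I_n) (b c : bool) (w : word).

Let XX b i j w : X (~~ b) i j :: X b i j :: w ~ w.
Proof. exact: (eqw_rel (relator_XX b i j)). Qed.
Let Xid b i w : X b i i :: w ~ w.
Proof. exact: (eqw_rel (relator_Xid b i)). Qed.
Let EE i w : E i :: E i :: w ~ w.
Proof. exact: (eqw_rel (relator_EE i)). Qed.
Let EC i j w : E i :: E j :: w ~ E j :: E i :: w.
Proof. exact: (eqw_rel (relator_ET i j)). Qed.
Let XC b c i j k l w : j != k -> i != l ->
  X b i j :: X c k l :: w ~ X c k l :: X b i j :: w.
Proof. by move=> jk il; exact: (eqw_rel (relator_XXc b c jk il)). Qed.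
Let XXX b c i j l w : i != j -> j != l -> i != l ->
  X b i j :: X c j l :: w ~ X (b == c) i l :: X c j l :: X b i j :: w.
Proof. by move=> ij jl il; exact: (eqw_rel (relator_XXX b c ij jl il)). Qed.
Let EX b i j k w :
  E k :: X b i j :: w ~ X (b (+) (k == i) (+) (k == j)) i j :: E k :: w.
Proof. exact: (eqw_rel (relator_EX b i j k)). Qed.
Let TX b i j k l w :
  T i j :: X b k l :: w ~ X b (swap i j k) (swap i j l) :: T i j :: w.
Proof. exact: (eqw_rel (relator_TX b i j k l)). Qed.
Let TE i j k w : T i j :: E k :: w ~ E (swap i j k) :: T i j :: w.
Proof. exact: (eqw_rel (relator_TE i j k)). Qed.
Let braid i j w : i != j ->
  E i :: X true j i :: T i j :: w ~ X false i j :: X true j i :: w.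
Proof. by move=> ij; exact: (eqw_rel (relator_braid ij)). Qed.

Definition sz f := \sum_i f i.
Definition dn i j f : {ffun 'I_n -> nat} := [ffun k => if k == i then f k - f j else f k].
Definition sw i j f : {ffun 'I_n -> nat} := [ffun k => f (swap i j k)].
Definition move f i j := [&& i \in J, j \in J, i != j, 0 < f j & f j <= f i].
Definition supp f := forall k, k \notin J -> f k = 0.

(** Each subtraction is recorded by the letter that undoes it, so the word rebuilds [f] from the
    vector where the algorithm stops. Among the possible moves [pick] makes an arbitrary choice. A
    move subtracts a positive entry, so fuel above the sum of the entries is never exhausted. *)
Fixpoint euclid_fuel (m : nat) f : word :=
  if m is m'.+1 then
    if [pick q | move f q.1 q.2] is Some q then X true q.1 q.2 :: euclid_fuel m' (dn q.1 q.2 f)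
    else if [pick i | 0 < f i] is Some i then base i else [::]
  else [::].
Definition euclid f := euclid_fuel (sz f).+1 f.

Lemma sz_dn f i j : move f i j -> sz (dn i j f) < sz f.
Proof.
case/and5P => iJ jJ ij j0 le; rewrite /sz (bigD1 i) //= [Y in _ < Y](bigD1 i) //=.
rewrite ffunE eqxx (eq_bigr (fun k => f k)); first by lia_numeric.
by move=> k /negbTE ki; rewrite ffunE ki.
Qed.

Lemma euclid_fuelE m f : sz f < m -> euclid_fuel m f = euclid f.
Proof.
suff H m' m'' g : sz g < m' -> sz g < m'' -> euclid_fuel m' g = euclid_fuel m'' g.
  by move=> lt; apply: H.
elim: m' m'' g => // m' IHm [//|m''] g lt1 lt2 /=.
case: pickP => [q /sz_dn Hq|//]; congr cons; apply: IHm; lia_numeric.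
Qed.

Lemma euclid_move f : (exists i j, move f i j) ->
  exists i j, move f i j /\ euclid f = X true i j :: euclid (dn i j f).
Proof.
move=> [i [j mij]]; rewrite /euclid [euclid_fuel _ f]/=.
case: pickP => [[k l] /= mkl|/(_ (i, j))]; last by rewrite /= mij.
by exists k, l; split=> //; congr cons; apply: euclid_fuelE; apply: sz_dn.
Qed.

(** Of two nonzero entries the smaller can be subtracted from the larger; hence without moves only
    the entry [k] is nonzero. *)
Lemma euclid_base f k : supp f -> (forall i j, ~~ move f i j) -> 0 < f k ->
  euclid f = base k.
Proof.
move=> sf nm k0; rewrite /euclid /=.
case: pickP => [[i j] /= m|_]; first by rewrite (negbTE (nm i j)) in m.
case: pickP => [i i0|/(_ k)]; last by rewrite k0.
have inJ x : 0 < f x -> x \in J by move=> x0; apply/negPn/negP => /sf; lia_numeric.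
case: (eqVneq i k) => [->//|ik].
have := nm i k; have := nm k i; rewrite /move !inJ // ik eq_sym ik k0 i0 /=; lia_numeric.
Qed.

Lemma supp_dn i j f : supp f -> supp (dn i j f).
Proof. by move=> sf k kJ; rewrite ffunE (sf k) // sub0n if_same. Qed.

Lemma supp_sw i j f : i \in J -> j \in J -> supp f -> supp (sw i j f).
Proof.
move=> iJ jJ sf k kJ; rewrite ffunE sf // /swap.
case: eqP kJ => [->|_]; first by rewrite iJ.
by case: eqP => [->|//]; rewrite jJ.
Qed.

Lemma sz_sw i j f : sz (sw i j f) = sz f.
Proof.
rewrite /sz [RHS](reindex_inj (inv_inj (swapK i j))) /=.
by apply: eq_bigr => k _; rewrite ffunE.
Qed.

Lemma move_sw i j f k l : i \in J -> j \in J -> move f k l ->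
  move (sw i j f) (swap i j k) (swap i j l).
Proof.
move=> iJ jJ /and5P[kJ lJ kl l0 le]; apply/and5P; rewrite !ffunE !swapK; split=> //.
- by rewrite /swap; case_indices.
- by rewrite /swap; case_indices.
- by rewrite (inj_eq (inv_inj (swapK i j))).
Qed.

Lemma dn_sw i j k l f : sw i j (dn k l f) = dn (swap i j k) (swap i j l) (sw i j f).
Proof.
apply/ffunP => x; rewrite !ffunE !swapK.
by rewrite -(inj_eq (inv_inj (swapK i j))) swapK.
Qed.

(* Confluence: a reduction step may be performed first whichever step [euclid] chose. *)
Definition euclid_spec f :=
  [/\ forall i j, move f i j -> euclid f ~ X true i j :: euclid (dn i j f),
      forall i j, i \in J -> j \in J -> i != j -> f j = 0 ->
        X true i j :: euclid f ~ euclid f,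
      forall k, k \in J -> f k = 0 -> E k :: euclid f ~ euclid f
    & forall k l, k \in J -> l \in J -> T k l :: euclid f ~ euclid (sw k l f)].

(** Subtracting a zero entry is no move, but the second clause then absorbs the letter. This spares
    the confluence diagrams the question which differences vanish. *)
Lemma spec_dn f i j : euclid_spec f -> i \in J -> j \in J -> i != j -> f j <= f i ->
  euclid f ~ X true i j :: euclid (dn i j f).
Proof.
move=> [Ha Hb _ _] iJ jJ ij le; case: (posnP (f j)) => [j0|j0].
  have -> : dn i j f = f.
    by apply/ffunP => k; rewrite ffunE j0 subn0 if_same.
  by symmetry; apply: Hb.
by apply: Ha; apply/and5P.
Qed.

Section Step.
Variable f : {ffun 'I_n -> nat}.
Hypothesis supp_f : supp f.
Hypothesis IHf : forall g, sz g < sz f -> supp g -> (exists x, 0 < g x) -> euclid_spec g.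

Let smaller i j : move f i j -> euclid_spec (dn i j f).
Proof.
move=> m; apply: IHf; [exact: sz_dn | exact: supp_dn | exists j].
by case/and5P: m => _ _ ij j0 _; rewrite ffunE eq_sym (negbTE ij).
Qed.

Let smaller2 i j k l : move f i j -> k \in J -> l \in J -> k != l ->
  dn i j f l <= dn i j f k -> (exists x, 0 < dn k l (dn i j f) x) ->
  euclid_spec (dn k l (dn i j f)).
Proof.
move=> m kJ lJ kl le ex; apply: IHf => //; last by do 2!apply: supp_dn.
case: (posnP (dn i j f l)) => [l0|l0].
  have -> : dn k l (dn i j f) = dn i j f.
    by apply/ffunP => x; rewrite [LHS]ffunE l0 subn0 if_same.
  exact: sz_dn.
by apply: ltn_trans (sz_dn m); apply: sz_dn; apply/and5P.
Qed.

(** As f_i - f_l - (f_j - f_l) = f_i - f_j, both paths meet once the entry j is reduced by l as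
    well, and the two words differ by the Steinberg relation [XXX]. *)
Let conf_target i j l : move f i j -> move f i l -> j != l -> f l <= f j ->
  X true i j :: euclid (dn i j f) ~ X true i l :: euclid (dn i l f).
Proof.
move=> mj ml jl le.
have /and5P[iJ jJ ij j0 lei] := mj; have /and5P[_ lJ il l0 leil] := ml.
rewrite (spec_dn (smaller ml) jJ lJ jl); last by rewrite !ffunE; case_indices; lia_numeric.
rewrite (@spec_dn (dn j l (dn i l f)) i j) //; first last.
- by rewrite !ffunE; case_indices; lia_numeric.
- apply: smaller2 => //; first by rewrite !ffunE; case_indices; lia_numeric.
  by exists l; rewrite !ffunE; case_indices.
rewrite (spec_dn (smaller mj) jJ lJ jl); last by rewrite !ffunE; case_indices; lia_numeric.
rewrite XXX //.
suff -> : dn i j (dn j l (dn i l f)) = dn j l (dn i j f) by reflexivity.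
by apply/ffunP => x; rewrite !ffunE; case_indices; lia_numeric.
Qed.

(** If j is reduced first, then i must be reduced by the new entry j and by l to reach the same
    vector: f_i - (f_j - f_l) - f_l = f_i - f_j. The extra letter is the commutator in [XXX]. *)
Let conf_chain i j l : move f i j -> move f j l -> i != l ->
  X true i j :: euclid (dn i j f) ~ X true j l :: euclid (dn j l f).
Proof.
move=> mj ml il.
have /and5P[iJ jJ ij j0 lei] := mj; have /and5P[_ lJ jl l0 lej] := ml.
rewrite (spec_dn (smaller mj) jJ lJ jl); last by rewrite !ffunE; case_indices; lia_numeric.
rewrite (spec_dn (smaller ml) iJ jJ ij); last by rewrite !ffunE; case_indices; lia_numeric.
rewrite (@spec_dn (dn i j (dn j l f)) i l) //; first last.
- by rewrite !ffunE; case_indices; lia_numeric.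
- apply: smaller2 => //; first by rewrite !ffunE; case_indices; lia_numeric.
  by exists l; rewrite !ffunE; case_indices.
have [ji lj li] : [/\ j != i, l != j & l != i] by split; rewrite eq_sym.
rewrite XXX //= (@XC true true i j i l) // (@XC true true j l i l) //.
suff -> : dn i l (dn i j (dn j l f)) = dn j l (dn i j f) by reflexivity.
by apply/ffunP => x; rewrite !ffunE; case_indices; lia_numeric.
Qed.


Let sw_dn_diag i j : f i = f j -> i != j -> sw i j (dn i j f) = dn j i f.
Proof.
move=> fij ij; apply/ffunP => x; rewrite !ffunE /swap.
by case_indices; rewrite ?fij ?subnn // -fij.
Qed.

(** The two moves annihilate different coordinates and lead to vectors that differ by [T i j]. After
    [braid] the letters [X true j i] and [E i] meet a vector whose entry i is zero, and are
    absorbed. *)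
Let conf_diag i j : move f i j -> move f j i ->
  X true i j :: euclid (dn i j f) ~ X true j i :: euclid (dn j i f).
Proof.
move=> mij mji; have [/and5P[iJ jJ ij j0 lei] /and5P[_ _ ji _ lej]] := (mij, mji).
have fij : f i = f j by lia_numeric.
have [_ Hb Hc Hd] := smaller mij.
have z : dn i j f i = 0 by rewrite ffunE eqxx fij subnn.
rewrite -(sw_dn_diag fij ij) -Hd //.
rewrite -(EE i (X true j i :: T i j :: _)) braid // (Hb j i) // EX /= eqxx (negbTE ij) /=.
by rewrite Hc //; reflexivity.
Qed.

Let conf i j k l : move f i j -> move f k l ->
  X true i j :: euclid (dn i j f) ~ X true k l :: euclid (dn k l f).
Proof.
move=> mij mkl; have [/and5P[iJ jJ ij j0 leij] /and5P[kJ lJ kl l0 lekl]] := (mij, mkl).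
case: (eqVneq i k) => [ik|ik]; first subst k.
  case: (eqVneq j l) => [->|jl]; first reflexivity.
  case: (leqP (f l) (f j)) => le; first exact: conf_target.
  by symmetry; apply: conf_target => //; [rewrite eq_sym | exact: ltnW].
case: (eqVneq i l) => [il|il]; first subst l.
  case: (eqVneq j k) => [jk|jk]; first by subst k; apply: conf_diag.
  by symmetry; apply: conf_chain; rewrite // eq_sym.
case: (eqVneq j k) => [jk|jk]; first by subst k; apply: conf_chain.
rewrite (spec_dn (smaller mij) kJ lJ kl); last by rewrite !ffunE; case_indices; lia_numeric.
rewrite (spec_dn (smaller mkl) iJ jJ ij); last by rewrite !ffunE; case_indices; lia_numeric.
rewrite XC //.
suff -> : dn k l (dn i j f) = dn i j (dn k l f) by reflexivity.
by apply/ffunP => x; rewrite !ffunE; case_indices; lia_numeric.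
Qed.

Lemma euclid_step i j : move f i j -> euclid f ~ X true i j :: euclid (dn i j f).
Proof.
move=> m; have [k [l [mkl ->]]] : exists k l, move f k l /\ euclid f = X true k l :: euclid (dn k l f).
  by apply: euclid_move; exists i, j.
exact: conf.
Qed.

End Step.

(** The first clause is assumed for all vectors of the same size, because the fourth one compares
    [f] with a permuted vector, on which the step chosen for [f], permuted likewise, must be
    available. *)
Let spec_of_step f : supp f -> (exists x, 0 < f x) ->
  (forall g, sz g < sz f -> supp g -> (exists x, 0 < g x) -> euclid_spec g) ->
  (forall g, sz g = sz f -> supp g -> forall i j, move g i j ->
     euclid g ~ X true i j :: euclid (dn i j g)) ->
  euclid_spec f.
Proof.
move=> sf nz IH step.
have [[i [j m]]|nm] := boolp.pselect (exists i j, move f i j).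
  have [k [l [mkl Ef]]] : exists k l, move f k l /\ euclid f = X true k l :: euclid (dn k l f).
    by apply: euclid_move; exists i, j.
  have /and5P[kJ lJ kl l0 le] := mkl.
  have [_ Hb Hc Hd] : euclid_spec (dn k l f).
    apply: IH; [exact: sz_dn | exact: supp_dn | exists l].
    by rewrite ffunE eq_sym (negbTE kl).
  split.
  - by move=> *; apply: step.
  - move=> x y xJ yJ xy y0.
    have yk : y != k by apply: contraTneq l0 => yk; move: le; rewrite -yk y0; lia_numeric.
    have yl : y != l by apply: contraTneq l0 => <-; rewrite y0.
    have dy : dn k l f y = 0 by rewrite ffunE (negbTE yk).
    (* For x = l the two letters do not commute; their commutator is a letter [X _ k y], which is
       absorbed too because the entry y is zero. *)
    rewrite Ef; case: (eqVneq x l) => [xl|xl].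
      subst x; have /(_ true true (euclid (dn k l f))) := XXX _ _ _ kl xy.
      rewrite eq_sym yk /= => /(_ isT) E1.
      transitivity (X false k y :: X true k l :: euclid (dn k l f)).
        rewrite -{2}(Hb l y) // E1 -[false]/(~~ true) XX; reflexivity.
      have [ky lk] : k != y /\ l != k by split; rewrite eq_sym.
      rewrite XC //.
      by rewrite -{1}(Hb k y) // -[false]/(~~ true) XX; reflexivity.
    by rewrite XC // Hb //; reflexivity.
  - move=> x xJ x0.
    have xk : x != k by apply: contraTneq l0 => xk; move: le; rewrite -xk x0; lia_numeric.
    have xl : x != l by apply: contraTneq l0 => <-; rewrite x0.
    rewrite Ef EX (negbTE xk) (negbTE xl) /= Hc //; first reflexivity.
    by rewrite ffunE (negbTE xk).
  - move=> x y xJ yJ; rewrite Ef TX Hd // dn_sw -step //; first reflexivity.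
    + exact: sz_sw.
    + exact: supp_sw.
    + exact: move_sw.
have nm' i j : ~~ move f i j by apply/negP => m; apply: nm; exists i, j.
have [k k0] := nz.
have kJ : k \in J by apply/negPn/negP => /sf; lia_numeric.
have Ef := euclid_base sf nm' k0.
split.
- by move=> i j m; case: nm; exists i, j.
- move=> i j iJ jJ ij j0; rewrite Ef; apply: base_X => //.
  by apply: contraTneq k0 => <-; rewrite j0.
- move=> i iJ i0; rewrite Ef; apply: base_E => //.
  by apply: contraTneq k0 => <-; rewrite i0.
- move=> i j iJ jJ; rewrite Ef (@euclid_base (sw i j f) (swap i j k)).
  + exact: base_T.
  + exact: supp_sw.
  + move=> x y; apply/negP => m; move: (nm' (swap i j x) (swap i j y)).
    have := move_sw iJ jJ m; suff -> : sw i j (sw i j f) = f by move=> ->.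
    by apply/ffunP => u; rewrite !ffunE swapK.
  + by rewrite ffunE swapK.
Qed.

Lemma euclidP f : supp f -> (exists x, 0 < f x) -> euclid_spec f.
Proof.
have [m] := ubnP (sz f); elim: m f => // m IHm f lt sf nz.
have IH g : sz g < sz f -> supp g -> (exists x, 0 < g x) -> euclid_spec g.
  by move=> lt'; apply: IHm; lia_numeric.
apply: spec_of_step => // g gf sg i j mv; apply: euclid_step => //.
by move=> h; rewrite gf; apply: IH.
Qed.


(** * Signed vectors and the equivariance of the section *)

Local Open Scope ring_scope.
Implicit Types v : 'cV[int]_n.

Definition absv v : {ffun 'I_n -> nat} := [ffun i => `|v i 0%R|%N].
Definition supported v := forall k, k \notin J -> v k 0 = 0.

(** A section, up to a positive factor, of the map that sends a word to the image of the base
    vector. The sign changes stand in front and so are applied after the Euclidean word. *)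
Definition section v : word :=
  foldr (fun i w => if v i 0 < 0 then E i :: w else w) (euclid (absv v)) (enum 'I_n).

Let specv v : supported v -> v != 0 -> euclid_spec (absv v).
Proof.
move=> sv nz; apply: euclidP; first by move=> k /sv; rewrite ffunE => ->.
suff [x vx] : exists x, v x 0 != 0 by exists x; rewrite ffunE absz_gt0.
apply/existsP; apply: contraNT nz => /existsPn H; apply/eqP/matrixP => i j.
by rewrite ord1 !mxE; apply/eqP; have := H i; rewrite negbK.
Qed.

Let absv_E k v : absv (lact (E k) v) = absv v.
Proof. by apply/ffunP => i; rewrite !ffunE mxE; case: eqP => // _; rewrite abszN. Qed.

(** If the entry k is nonzero, the sign change toggles [E k] in the prefix. If it is zero, the
    prefix stays the same, and [E k] passes through it to the Euclidean word, which absorbs it. *)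
Let section_E k v : k \in J -> supported v -> v != 0 ->
  E k :: section v ~ section (lact (E k) v).
Proof.
move=> kJ sv nz; rewrite /section absv_E.
have [_ _ Hc _] := specv sv nz.
have pass (L : seq 'I_n) : k \notin L \/ v k 0 = 0 ->
    E k :: foldr (fun i w => if v i 0 < 0 then E i :: w else w) (euclid (absv v)) L ~
    foldr (fun i w => if v i 0 < 0 then E i :: w else w) (E k :: euclid (absv v)) L.
  move=> _; elim: L => [|i L IHL] /=; first reflexivity.
  by case: ifP => _; rewrite 1?EC IHL; reflexivity.
have agree (L : seq 'I_n) w : k \notin L \/ v k 0 = 0 ->
    foldr (fun i w => if lact (E k) v i 0 < 0 then E i :: w else w) w L =
    foldr (fun i w => if v i 0 < 0 then E i :: w else w) w L.
  move=> H; elim: L H => //= i L IHL H; rewrite IHL; last first.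
    by case: H; [rewrite inE negb_or => /andP[_ ?]; left | right].
  rewrite mxE; case: eqVneq H => // <- []; first by rewrite inE eqxx.
  by move=> ->; rewrite oppr0.
case: (eqVneq (v k 0) 0) => [v0|v0].
  rewrite pass; last by right.
  rewrite agree; last by right.
  elim: (enum _) => [|i L IHL] /=; first by apply: Hc => //; rewrite ffunE v0.
  by case: ifP => _; rewrite IHL; reflexivity.
have : k \in enum 'I_n by rewrite mem_enum.
elim: (enum _) (enum_uniq 'I_n) => //= i L IHL /andP[iL uL].
rewrite inE => /predU1P[ki|kL]; first subst i.
  rewrite agree; last by left.
  rewrite mxE eqxx oppr_lt0; case: ltgtP v0 => // _ _; first reflexivity.
rewrite mxE; have /negbTE-> : i != k by apply: contraNneq iL => ->.
by case: ifP => _; rewrite -?IHL // 1?EC; reflexivity.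
Qed.

Let section_ge0 v : (forall i, 0 <= v i 0) -> section v = euclid (absv v).
Proof.
move=> v0; rewrite /section; elim: (enum _) => //= i L ->.
by rewrite ltNge v0.
Qed.

Let lact_supported a v : letter_in J a -> supported v -> supported (lact a v).
Proof.
case: a => [[[b i] j]|[i|[i j]]] /=.
- move=> /andP[iJ jJ] sv k kJ; rewrite mxE sv //.
  by case: eqVneq kJ => //= ->; rewrite iJ.
- by move=> iJ sv k kJ; rewrite mxE sv // oppr0 if_same.
- move=> /andP[iJ jJ] sv k kJ; rewrite mxE sv // /swap.
  case: eqVneq kJ => [->|_]; first by rewrite iJ.
  by case: eqVneq => [->|//]; rewrite jJ.
Qed.

Let lact_neq0 a v : v != 0 -> lact a v != 0.
Proof.
apply: contraNneq => av0; rewrite -(lact_inv a v) av0.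
apply/eqP/matrixP => i j; case: (linv a) => [[[b k] l]|[k|[k l]]];
  by rewrite !mxE ?oppr0 ?addr0 ?subr0 ?if_same.
Qed.

Let section_T i j v : i \in J -> j \in J -> supported v -> v != 0 ->
  (forall k, 0 <= v k 0) -> T i j :: section v ~ section (lact (T i j) v).
Proof.
move=> iJ jJ sv nz v0; rewrite !section_ge0 //; last by move=> k; rewrite mxE.
have [_ _ _ Hd] := specv sv nz; rewrite Hd //.
suff -> : sw i j (absv v) = absv (lact (T i j) v) by reflexivity.
by apply/ffunP => k; rewrite !ffunE mxE.
Qed.

(** On nonnegative vectors an addition inverts a Euclidean subtraction, so this is one step of
    [euclid] for the larger vector. *)
Let section_up i j v : i \in J -> j \in J -> i != j -> supported v -> v != 0 ->
  (forall k, 0 <= v k 0) -> X true i j :: section v ~ section (lact (X true i j) v).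
Proof.
move=> iJ jJ ij sv nz v0; rewrite !section_ge0 //; last first.
  by move=> k; rewrite mxE; case: ifP; rewrite ?addr_ge0.
symmetry; rewrite (@spec_dn (absv (lact (X true i j) v)) i j) //.
- suff -> : dn i j (absv (lact (X true i j) v)) = absv v by reflexivity.
  apply/ffunP => k; rewrite !ffunE !mxE ij (eq_sym j) (negbTE ij) andbT /=.
  by case: eqVneq => // ->; have := v0 i; have := v0 j; lia_numeric.
- by apply: specv; [apply: lact_supported => //=; rewrite iJ | apply: lact_neq0].
- rewrite !ffunE !mxE ij (eq_sym j) (negbTE ij) eqxx /=.
  by have := v0 i; have := v0 j; lia_numeric.
Qed.

(** If the entry i would become negative, its sign is changed; the entries at i and j are then v_j -
    v_i and v_j. Reducing the second by the first gives v_j - v_i and v_i, whereas the same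
    reduction of [v] gives v_i and v_j - v_i. The results differ by [T i j], and [braid] compares
    the words. *)
Let section_down i j v : i \in J -> j \in J -> i != j -> supported v -> v != 0 ->
  (forall k, 0 <= v k 0) -> X false i j :: section v ~ section (lact (X false i j) v).
Proof.
move=> iJ jJ ij sv nz v0.
case: (lerP (v j 0) (v i 0)) => le.
  have w0 k : 0 <= lact (X false i j) v k 0.
    rewrite mxE ij andbT; case: eqVneq => [->|_] //; by rewrite subr_ge0.
  have E1 : lact (X true i j) (lact (X false i j) v) = v by apply: (lact_inv (X false i j)).
  rewrite -{1}E1 -section_up //; first by rewrite -[false]/(~~ true) XX; reflexivity.
  - by apply: lact_supported => //=; rewrite iJ.
  - exact: lact_neq0.
set v' := lact _ v; set v2 := lact (E i) v'.
have ji : j != i by rewrite eq_sym.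
have sv' : supported v' by apply: lact_supported => //=; rewrite iJ.
have nz' : v' != 0 by apply: lact_neq0.
have sv2 : supported v2 by apply: lact_supported.
have nz2 : v2 != 0 by apply: lact_neq0.
have v2E k : v2 k 0 = if k == i then v j 0 - v i 0 else v k 0.
  by rewrite !mxE ij; case: eqVneq => //= ->; rewrite opprB.
have v20 k : 0 <= v2 k 0.
  by rewrite v2E; case: eqVneq => // _; rewrite subr_ge0 ltW.
have -> : v' = lact (E i) v2 by rewrite -[LHS](lact_inv (E i)).
rewrite -section_E // !section_ge0 //.
have [_ _ _ Hd] := specv sv nz.
rewrite (@spec_dn (absv v) j i) //; first last.
- by rewrite !ffunE; have := v0 i; have := v0 j; lia_numeric.
- exact: specv.
rewrite (@spec_dn (absv v2) j i) //; first last.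
- by rewrite !ffunE !v2E eqxx (negbTE ji); have := v0 i; have := v0 j; lia_numeric.
- exact: specv.
have -> : dn j i (absv v2) = sw i j (dn j i (absv v)).
  apply/ffunP => k; rewrite !ffunE /swap !v2E eqxx.
  by case: (eqVneq k i) => [->|ki]; rewrite ?eqxx ?(negbTE ij) ?(negbTE ji) /=;
     [|case: (eqVneq k j) => [->|kj]; rewrite ?eqxx ?(negbTE ij) ?(negbTE kj)];
     have := v0 i; have := v0 j; lia_numeric.
have sd : supp (dn j i (absv v)).
  by apply: supp_dn => k /sv; rewrite ffunE => ->.
have [|_ _ _ <-] // := @euclidP (dn j i (absv v)) sd.
  by exists j; rewrite !ffunE eqxx; have := v0 i; have := v0 j; lia_numeric.
by rewrite braid //; reflexivity.
Qed.

(** Induction on the number of negative entries. Writing [v] as the image under [E k] of a vector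
    with one negative entry less, a relation moves the sign change across the letter; so only
    nonnegative vectors call for a study of each kind of letter. *)
Lemma section_lact a v : letter_in J a -> supported v -> v != 0 ->
  a :: section v ~ section (lact a v).
Proof.
have [m] := ubnP #|[set k | (v k 0 < 0)%R]|; elim: m a v => // m IHm a v lt aJ sv nz.
have [[k vk]|pos] := boolp.pselect (exists k, v k 0 < 0); last first.
  have v0 k : 0 <= v k 0 by rewrite leNgt; apply/negP => vk; apply: pos; exists k.
  case: a aJ => [[[b i] j]|[i|[i j]]].
  - move=> /andP[iJ jJ]; case: (eqVneq i j) => [<-|ij].
      rewrite Xid; suff -> : lact (X b i i) v = v by reflexivity.
      by apply/matrixP => x y; rewrite !mxE eqxx andbF.
    by case: b; [apply: section_up | apply: section_down].
  - by move=> iJ; apply: section_E.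
  - by move=> /andP[iJ jJ]; apply: section_T.
have kJ : k \in J by apply/negPn/negP => /sv e; rewrite e ltxx in vk.
set v' := lact (E k) v.
have vE : v = lact (E k) v' by rewrite -[LHS](lact_inv (E k)).
have sv' : supported v' by apply: lact_supported.
have nz' : v' != 0 by apply: lact_neq0.
have lt' : (#|[set x | (v' x 0 < 0)%R]| < m)%N.
  have := lt; rewrite ltnS; apply: leq_trans; apply: proper_card; apply/properP.
  split; last by exists k; rewrite !inE ?mxE ?eqxx //; lia_numeric.
  by apply/subsetP => x; rewrite !inE mxE; case: eqVneq => // ->; lia_numeric.
suff [k' [a' [k'J a'J Ha va]]] : exists k' a', [/\ k' \in J, letter_in J a',
    forall w, a :: E k :: w ~ E k' :: a' :: w &
    lact a (lact (E k) v') = lact (E k') (lact a' v')].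
  rewrite vE va -(section_E kJ) // Ha IHm // section_E //.
  - reflexivity.
  - exact: lact_supported.
  - exact: lact_neq0.
have rel u w : relator u w -> wact u v' = wact w v'.
  by move=> /and3P[_ _ /eqP e]; rewrite !wactE e.
case: a aJ => [[[b i] j]|[i|[i j]]] aJ.
- have sgnK s t : b (+) s (+) t (+) s (+) t = b by case: (b); case: s; case: t.
  exists k, (X (b (+) (k == i) (+) (k == j)) i j); split=> //.
    by move=> w; rewrite EX sgnK; reflexivity.
  by have := rel _ _ (relator_EX (b (+) (k == i) (+) (k == j)) i j k); rewrite sgnK => /esym.
- by exists k, (E i); split=> //; apply: (rel _ _ (relator_ET i k)).
- exists (swap i j k), (T i j); split=> //.
  + by have /andP[iJ jJ] := aJ; rewrite /swap; case: ifP => // _; case: ifP.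
  + exact: (rel _ _ (relator_TE i j k)).
Qed.

Lemma section_wact u v : all (letter_in J) u -> supported v -> v != 0 ->
  [/\ u ++ section v ~ section (wact u v), supported (wact u v) & wact u v != 0].
Proof.
move=> + sv nz; elim: u => [|a u IHu] /=; first by split=> //; reflexivity.
move=> /andP[aJ /IHu[Hu su nzu]]; split.
- by rewrite Hu section_lact //; reflexivity.
- exact: lact_supported.
- exact: lact_neq0.
Qed.

Lemma section_delta i : i \in J -> section (delta_mx i 0) = base i.
Proof.
move=> iJ; have dE k : (delta_mx i 0 : 'cV[int]_n) k 0 = (k == i)%:R.
  by rewrite mxE eqxx andbT.
rewrite section_ge0; last by move=> k; rewrite dE; case: (_ == _).
have aE k : absv (delta_mx i 0) k = (k == i) :> nat by rewrite ffunE dE; case: (k == i).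
apply: euclid_base; last by rewrite aE eqxx.
- by move=> k kJ; rewrite aE; case: eqVneq kJ => // ->; rewrite iJ.
- move=> k l; apply/negP => /and5P[_ _ kl]; rewrite !aE.
  by case: (eqVneq l i) kl => // -> /negbTE->.
Qed.

Section Value.
Variable e : 'cV[int]_n.
Hypothesis base_in : forall i, i \in J -> all (letter_in J) (base i).
Hypothesis base_val : forall i, i \in J -> wact (base i) e = delta_mx i 0.

Let colv f : 'cV[int]_n := \col_i (f i)%:Z.

Let euclid_val f : supp f -> (exists x, (0 < f x)%N) ->
  all (letter_in J) (euclid f) /\
  exists2 d : nat, (0 < d)%N & colv f = d%:Z *: wact (euclid f) e.
Proof.
have [m] := ubnP (sz f); elim: m f => // m IHm f lt sf nz.
have [[i [j mv]]|nm] := boolp.pselect (exists i j, move f i j).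
  have [k [l [mkl ->]]] := euclid_move (ex_intro _ i (ex_intro _ j mv)).
  have /and5P[kJ lJ kl l0 le] := mkl.
  have [||| Ha [d d0 Ed]] := IHm (dn k l f).
  - by apply: leq_trans (sz_dn mkl) _.
  - exact: supp_dn.
  - by exists l; rewrite ffunE eq_sym (negbTE kl).
  split; first by rewrite /= kJ lJ Ha.
  exists d => //; rewrite -cat1s wact_cat wactE scalemxAr -Ed -wactE /=.
  apply/matrixP => x y; rewrite !mxE !ffunE kl andbT (eq_sym l) (negbTE kl).
  by case: eqVneq => // ->; rewrite -PoszD subnK.
have [k k0] := nz; have nm' i j : ~~ move f i j.
  by apply/negP => m'; apply: nm; exists i, j.
have inJ x : (0 < f x)%N -> x \in J by move=> x0; apply/negPn/negP => /sf; lia_numeric.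
have kJ := inJ _ k0.
rewrite (euclid_base sf nm' k0) base_in //; split=> //; exists (f k) => //.
rewrite base_val //; apply/matrixP => x y; rewrite ord1 !mxE eqxx andbT.
case: (eqVneq x k) => [->|xk]; first by rewrite mulr1.
rewrite mulr0; case: (posnP (f x)) => [-> //|x0].
have := nm' x k; have := nm' k x; rewrite /move !inJ // xk eq_sym xk k0 x0 /=; lia_numeric.
Qed.

(** The factor d is the entry that remains when no move is possible, the greatest common divisor.
    The lemma serves both the generation of the group and the normal form of rational vectors. *)
Lemma section_val v : supported v -> v != 0 ->
  all (letter_in J) (section v) /\
  exists2 d : nat, (0 < d)%N & v = d%:Z *: wact (section v) e.
Proof.
move=> sv nz.
have [||Ha [d d0 Ed]] := @euclid_val (absv v).
- by move=> k /sv; rewrite ffunE => ->.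
- suff [x vx] : exists x, v x 0 != 0 by exists x; rewrite ffunE absz_gt0.
  apply/existsP; apply: contraNT nz => /existsPn H; apply/eqP/matrixP => i j.
  by rewrite ord1 !mxE; apply/eqP; have := H i; rewrite negbK.
split.
  rewrite /section; elim: (enum _) => //= i L IHL; case: ifP => //= vi.
  rewrite IHL andbT; apply/negPn/negP => /sv e0; by rewrite e0 ltxx in vi.
exists d => //; rewrite /section.
set g := fun i w => _; have gE (L : seq 'I_n) : uniq L ->
    d%:Z *: wact (foldr g (euclid (absv v)) L) e =
    \col_i (if (i \in L) then v i 0 else `|v i 0|).
  elim: L => [_|i L IHL] /=.
    by rewrite -Ed; apply/matrixP => x y; rewrite !mxE ffunE abszE.
  move=> /andP[iL /IHL{}IHL]; rewrite {1}/g; case: ifP => vi.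
    rewrite -cat1s wact_cat wactE scalemxAr IHL -wactE /=; apply/matrixP => x y.
    rewrite ord1 !mxE inE; case: (eqVneq x i) => [->|] //=.
    by rewrite (negbTE iL) ltr0_norm // opprK.
  rewrite IHL; apply/matrixP => x y; rewrite ord1 !mxE inE.
  by case: (eqVneq x i) => [->|] //=; rewrite (negbTE iL) ger0_norm // leNgt vi.
rewrite gE ?enum_uniq //; apply/matrixP => x y.
by rewrite ord1 mxE mem_enum.
Qed.

End Value.
End Euclid.

(** * Words modulo the relations, and the structure of the stabilizer of a basis vector *)

Arguments wval : simpl never.

Section Presentation.
Variable n : nat.
Local Notation letter := (letter n).
Local Notation word := (seq letter).
Implicit Types (a : letter) (i j k l p : 'I_n) (b c : bool) (u w t q : word).
Implicit Types J : {set 'I_n}.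

(** Relations are applied at the head of a word and carried inward by [EqvCons]. Compatibility with
    appending on the right is derived, so an action that evaluates words from the right has few
    cases to respect. *)
Inductive eqv : word -> word -> Prop :=
| EqvRefl w : eqv w w
| EqvSym u w : eqv u w -> eqv w u
| EqvTrans u w t : eqv u w -> eqv w t -> eqv u t
| EqvCons a u w : eqv u w -> eqv (a :: u) (a :: w)
| EqvRel u w t : relator u w -> eqv (u ++ t) (w ++ t).

Local Notation "u ~ w" := (eqv u w) (at level 70).

#[local] Instance eqv_equiv : Equivalence eqv.
Proof.
split; [exact: EqvRefl | exact: EqvSym | move=> u w t; exact: EqvTrans].
Qed.

#[local] Instance eqv_cons a : Proper (eqv ==> eqv) (cons a).
Proof. by move=> u w; apply: EqvCons. Qed.

#[local] Instance eqv_cat : Proper (eqv ==> eqv ==> eqv) cat.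
Proof.
have Hl t u w : u ~ w -> t ++ u ~ t ++ w by elim: t => //= a t IHt /IHt ->; reflexivity.
have Hr u w : u ~ w -> forall t, u ++ t ~ w ++ t.
  elim=> {u w} [w|u w _ IH|u v w _ IH1 _ IH2|a u w _ IH|u w t r] x; first reflexivity.
  - by symmetry.
  - by rewrite IH1.
  - by rewrite /= IH; reflexivity.
  - by rewrite -!catA; apply: EqvRel.
by move=> u w uw x y xy; rewrite (Hl _ _ _ xy); apply: Hr.
Qed.

Lemma eqv_wval u w : u ~ w -> wval u = wval w.
Proof.
elim=> {u w} [//|//|u w t _ -> _ -> //|a u w _ IH|u w t /and3P[_ _ /eqP E]].
  by rewrite !val_cons IH.
by rewrite !val_cat E.
Qed.

Let rel u w (r : relator u w) t : u ++ t ~ w ++ t := EqvRel t r.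

Lemma eqv_linv a t : linv a :: a :: t ~ t.
Proof.
case: a => [[[b i] j]|[i|[i j]]].
- exact: (rel (relator_XX b i j)).
- exact: (rel (relator_EE i)).
- exact: (rel (relator_TT i j)).
Qed.

Lemma eqv_winvl w : winv w ++ w ~ [::].
Proof.
elim: w => [|a w IHw]; first reflexivity.
rewrite -cat1s winv_cat /winv [map _ [:: a]]/= {2}/rev /= -catA /=.
by rewrite eqv_linv.
Qed.

Lemma eqv_winvr w : w ++ winv w ~ [::].
Proof. by rewrite -{1}(winvK w) eqv_winvl; reflexivity. Qed.

(** These letters fix e_p, since [X _ _ l] adds a multiple of the coordinate l, which is zero there.
    They will be shown to generate its stabilizer. *)
Definition stab_letter J p a : bool :=
  letter_in J a &&
  match a with
  | X _ _ l => l != p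
  | E i => i != p
  | T i j => (i != p) && (j != p)
  end.

Lemma stab_letter_inv J p a : stab_letter J p (linv a) = stab_letter J p a.
Proof. by case: a => [[[b i] j]|a]. Qed.

Lemma all_winv (P : pred letter) w : (forall a, P (linv a) = P a) ->
  all P (winv w) = all P w.
Proof. by move=> H; rewrite all_rev all_map; apply: eq_all => a /=. Qed.

Section Step.
Variables (J : {set 'I_n}) (p : 'I_n).
Hypothesis pJ : p \in J.
Local Notation P := (stab_letter J p).

Definition coset_eqv u w := exists2 q, all P q & u ~ w ++ q.

Let coset_equiv : Equivalence coset_eqv.
Proof.
split.
- by move=> w; exists [::]; rewrite ?cats0 //; reflexivity.
- move=> u w [q Pq uw]; exists (winv q); first by rewrite all_winv // => a; apply: stab_letter_inv.
  by rewrite uw -catA eqv_winvr cats0; reflexivity.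
- move=> u w t [q Pq uw] [q' Pq' wt]; exists (q' ++ q); first by rewrite all_cat Pq'.
  by rewrite uw wt catA; reflexivity.
Qed.

Let coset_cons a : Proper (coset_eqv ==> coset_eqv) (cons a).
Proof. by move=> u w [q Pq uw]; exists q => //=; rewrite uw; reflexivity. Qed.

Let coset_eqv_of u w : u ~ w -> coset_eqv u w.
Proof. by exists [::]; rewrite ?cats0. Qed.

Let coset_rel u w : relator u w -> forall t, coset_eqv (u ++ t) (w ++ t).
Proof. by move=> r t; apply: coset_eqv_of; apply: rel. Qed.

Definition base i : word := [:: T i p].

Let swap_neq i k : k != i -> swap i p k != p.
Proof. by move=> ki; rewrite /swap (negbTE ki); case_indices; rewrite eq_sym. Qed.

Let swap_in i j k : i \in J -> j \in J -> k \in J -> swap i j k \in J.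
Proof. by move=> iJ jJ kJ; rewrite /swap; case: ifP => // _; case: ifP. Qed.

Let base_X b i k l : i \in J -> k \in J -> l \in J -> l != i ->
  coset_eqv (X b k l :: base i) (base i).
Proof.
move=> iJ kJ lJ li; exists [:: X b (swap i p k) (swap i p l)].
  by rewrite /stab_letter /= !swap_in // swap_neq.
rewrite /base /=; have := rel (relator_TX b i p (swap i p k) (swap i p l)) [::].
by rewrite /= !swapK => ->; reflexivity.
Qed.

Let base_E i k : i \in J -> k \in J -> k != i -> coset_eqv (E k :: base i) (base i).
Proof.
move=> iJ kJ ki; exists [:: E (swap i p k)].
  by rewrite /stab_letter /= swap_in // swap_neq.
rewrite /base /=; have := rel (relator_TE i p (swap i p k)) [::].
by rewrite /= !swapK => ->; reflexivity.
Qed.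

Let base_T i k l : i \in J -> k \in J -> l \in J ->
  coset_eqv (T k l :: base i) (base (swap k l i)).
Proof.
have case1 k' l' : k' \in J -> l' \in J -> coset_eqv (T k' l' :: base k') (base l').
  move=> kJ lJ; case: (eqVneq l' k') => [->|lk].
    by apply: coset_eqv_of; apply: (rel (relator_Tid k') (base k')).
  case: (eqVneq k' p) => [->|kp].
    apply: coset_eqv_of; rewrite /base.
    transitivity ([:: T l' p; T p p] : word); first exact: (rel (relator_Tsym p l') [:: T p p]).
    exact: (EqvCons _ (rel (relator_Tid p) [::])).
  case: (eqVneq l' p) => [->|lp].
    apply: coset_eqv_of; rewrite /base.
    transitivity ([::] : word); first exact: (rel (relator_TT k' p) [::]).
    by symmetry; exact: (rel (relator_Tid p) [::]).
  exists [:: T k' l']; first by rewrite /stab_letter /= kJ lJ kp lp.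
  have := rel (relator_TTc k' l' k' p) [::]; rewrite /base /= {1 2}/swap eqxx.
  by rewrite eq_sym (negbTE kp) eq_sym (negbTE lp) => ->; reflexivity.
move=> iJ kJ lJ; case: (eqVneq i k) => [->|ik].
  have -> : swap k l k = l by rewrite /swap eqxx.
  exact: case1.
case: (eqVneq i l) => [->|il].
  have -> : swap k l l = k by rewrite /swap eqxx; case: eqP.
  have [q Pq Hq] := case1 l k lJ kJ; exists q => //.
  by rewrite -Hq; apply: (rel (relator_Tsym k l) (base l)).
have -> : swap k l i = i by rewrite /swap (negbTE ik) (negbTE il).
exists [:: T (swap i p k) (swap i p l)].
  by rewrite /stab_letter /= !swap_in // !swap_neq // eq_sym.
rewrite /base /=; have := rel (relator_TTc i p (swap i p k) (swap i p l)) [::].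
by rewrite /= !swapK => ->; reflexivity.
Qed.

Local Open Scope ring_scope.

Let supp_delta : supported J (delta_mx p 0 : 'cV[int]_n).
Proof.
by move=> k kJ; rewrite mxE; case: eqVneq kJ => // ->; rewrite pJ.
Qed.

Let delta_neq0 : (delta_mx p 0 : 'cV[int]_n) != 0.
Proof. by apply/eqP => /matrixP/(_ p ord0)/eqP; rewrite !mxE !eqxx. Qed.

(* A word fixing the base vector represents the base coset, because the section
   commutes with it. *)
Lemma eqv_stab_word w : all (letter_in J) w ->
  wact w (delta_mx p 0 : 'cV[int]_n) = delta_mx p 0 -> exists2 q, all P q & w ~ q.
Proof.
move=> wJ wp.
have [+ _ _] := @section_wact n J coset_eqv base coset_equiv coset_cons coset_rel
  base_X base_E base_T w _ wJ supp_delta delta_neq0.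
have T0 : base p ~ [::] := rel (relator_Tid p) [::].
by rewrite wp section_delta // => -[q Pq]; rewrite T0 cats0 => Hq; exists q.
Qed.

(** In the stabilizer of e_p these letters generate the kernel of the restriction to the rows and
    columns other than p. They commute and change row p only. *)
Definition translation a : bool :=
  if a is X _ i k then [&& i == p, k \in J & k != p] else false.

Local Notation L := (letter_in (J :\ p)).

Lemma stab_letterE a : P a = translation a || L a.
Proof.
case: a => [[[b i] j]|[i|[i j]]]; rewrite /stab_letter /= ?in_setD1.
- by case: (eqVneq i p) => [->|_] /=; rewrite ?pJ; case: (j \in J); case: (i \in J); case: (j == p).
- by rewrite andbC.
- by case: (i \in J); case: (j \in J); case: (i == p); case: (j == p).
Qed.

(** Letters that avoid p normalise the translations. A second translation appears only when
    [X b k l] passes [X c p k], by the Steinberg relation. *)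
Let push1 a x t : L a -> translation x ->
  exists2 u, all translation u & a :: x :: t ~ u ++ a :: t.
Proof.
case: x => [[[c i] m]|//] aL /= /and3P[/eqP-> mJ mp].
case: a aL => [[[b k] l]|[k|[k l]]] /=; rewrite !in_setD1.
- move=> /andP[/andP[kp kJ] /andP[lp lJ]].
  case: (eqVneq k l) => [<-|kl].
    exists [:: X c p m]; first by rewrite /= eqxx mJ mp.
    transitivity (X c p m :: t); first exact: (rel (relator_Xid b k)).
    by apply: EqvCons; symmetry; exact: (rel (relator_Xid b k)).
  case: (eqVneq m k) => [mk|mk]; last first.
    exists [:: X c p m]; first by rewrite /= eqxx mJ mp.
    by apply: (rel (relator_XXc b c _ _)); rewrite // eq_sym.
  subst m; exists [:: X (~~ (c == b)) p l; X c p k].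
    by rewrite /= !eqxx mJ mp lJ lp.
  have pk : p != k by rewrite eq_sym.
  have pl : p != l by rewrite eq_sym.
  have H := rel (relator_XXX c b pk kl pl) t.
  transitivity (X (~~ (c == b)) p l :: X (c == b) p l :: X b k l :: X c p k :: t).
    by symmetry; exact: (rel (relator_XX (c == b) p l)).
  by apply: EqvCons; symmetry.
- move=> /andP[kp kJ].
  exists [:: X (c (+) (k == p) (+) (k == m)) p m]; first by rewrite /= eqxx mJ mp.
  exact: (rel (relator_EX c p m k)).
- move=> /andP[/andP[kp kJ] /andP[lp lJ]].
  exists [:: X c (swap k l p) (swap k l m)].
    rewrite /= swap_in // /swap (eq_sym p k) (eq_sym p l) (negbTE kp) (negbTE lp) eqxx /=.
    by rewrite andbT; case: ifP => // _; case: ifP.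
  exact: (rel (relator_TX c k l p m)).
Qed.

Let push u a : L a -> all translation u ->
  exists2 u', all translation u' & a :: u ~ u' ++ [:: a].
Proof.
move=> aL; elim: u => [|x u IHu] /=; first by exists [::] => //; reflexivity.
move=> /andP[xU /IHu[u' u'U Hu]].
have [v vU Hv] := push1 u aL xU; exists (v ++ u'); first by rewrite all_cat vU.
by rewrite Hv Hu catA; reflexivity.
Qed.

Lemma stab_decomposition q : all P q ->
  exists u w, [/\ all translation u, all L w & q ~ u ++ w].
Proof.
elim: q => [|a q IHq] /=; first by exists [::], [::]; split=> //; reflexivity.
move=> /andP[]; rewrite stab_letterE => aP /IHq[u [w [uU wL Hq]]].
case/orP: aP => [aU|aL].
  by exists (a :: u), w; split=> //=; [rewrite aU | rewrite Hq; reflexivity].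
have [u' u'U Hu] := push aL uU; exists u', (a :: w); split=> //=; first by rewrite aL.
by rewrite Hq -cat_cons Hu -catA; reflexivity.
Qed.

Let translation_row u m (M : 'M[int]_(n, m)) i r : all translation u -> i != p ->
  wact u M i r = M i r.
Proof.
move=> + ip; elim: u => //= -[[[b x] k]|//] u IHu /= /andP[/and3P[/eqP-> _ _] /IHu IH].
by rewrite mxE (negbTE ip).
Qed.

Let L_row w m (M : 'M[int]_(n, m)) r : all L w -> wact w M p r = M p r.
Proof.
elim: w => //= a w IHw /andP[aL /IHw IH].
case: a aL => [[[b x] k]|[x|[x k]]] /=; rewrite !in_setD1 mxE.
- by move=> /andP[/andP[xp _] _]; rewrite eq_sym (negbTE xp).
- by move=> /andP[xp _]; rewrite eq_sym (negbTE xp).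
- move=> /andP[/andP[xp _] /andP[kp _]].
  by rewrite /swap eq_sym (negbTE xp) eq_sym (negbTE kp).
Qed.

Let translation_inv u : all translation u -> all translation (winv u).
Proof. by rewrite all_winv // => -[[[b x] k]|a]. Qed.

(** Without the inverse letter, all occurrences of [X b p k] push the entry (p, k) in the same
    direction. So a word of translations that begins with [X b p k] and has value 1 must contain the
    inverse letter. *)
Let translation_entry b k u : k != p -> all translation u -> X (~~ b) p k \notin u ->
  0 <= (-1) ^+ (~~ b) * wval u p k.
Proof.
move=> kp; elim: u => [|a u IHu] /=.
  by rewrite mxE eq_sym (negbTE kp) mulr0.
case: a => [[[c x] m]|//] /= /andP[/and3P[/eqP-> mJ mp] uU].
rewrite inE negb_or => /andP[ne /(IHu uU)].
rewrite !val_cons !mxE eqxx (eq_sym p) mp /= [wval u m k]translation_row // mxE.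
case: (eqVneq m k) ne => [->|_] /=; last by case: c; rewrite ?addr0 ?subr0.
by case: (b); case: (c); rewrite ?eqxx //= ?expr0 ?expr1; lia_numeric.
Qed.

(* Translations commute, so an inverse pair of letters can be cancelled wherever the
   two letters stand. *)
Let translation_trivial u : all translation u -> wval u = 1%:M -> u ~ [::].
Proof.
have [m] := ubnP (size u); elim: m u => // m IHm [_ _ _|a u]; first reflexivity.
case: a => [[[b x] k]|//]; rewrite /= ltnS => su /andP[/and3P[/eqP-> kJ kp] uU] Hu.
case: (boolP (X (~~ b) p k \in u)) => [xu|xu]; last first.
  have := translation_entry kp uU xu; have /matrixP/(_ p k) := Hu.
  rewrite val_cons !mxE eqxx (eq_sym p k) kp /= [wval u k k]translation_row // mxE.
  by rewrite eqxx (negbTE kp); case: (b) => /=; lia.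
case/splitPr: xu => u1 u2 in su uU Hu *.
have [u1U /= /andP[_ u2U]] : all translation u1 /\ all translation (X (~~ b) p k :: u2).
  by apply/andP; rewrite -all_cat.
have comm v : all translation v -> forall t, X b p k :: v ++ t ~ v ++ X b p k :: t.
  elim: v => [|[[[c x'] l]|//] v IHv] /=; first by reflexivity.
  move=> /andP[/and3P[/eqP-> _ lp] vU] t; rewrite -IHv //.
  by apply: (rel (relator_XXc b c _ _)) => //; rewrite eq_sym.
have E0 : X b p k :: u1 ++ X (~~ b) p k :: u2 ~ u1 ++ u2.
  rewrite comm //; have := eqv_linv (X (~~ b) p k) u2; rewrite /= negbK => ->.
  reflexivity.
rewrite E0; apply: IHm.
- by move: su; rewrite !size_cat /=; lia.
- by rewrite all_cat u1U.
- by rewrite -(eqv_wval E0).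
Qed.

(** Translations touch row p only, and a word that avoids p touches the other rows only. Hence their
    product is 1 only if both factors are, and each factor is trivial by its own argument. *)
Lemma eqv_trivial_step : (forall w, all L w -> wval w = 1%:M -> w ~ [::]) ->
  forall w, all (letter_in J) w -> wval w = 1%:M -> w ~ [::].
Proof.
move=> IH w wJ w1; have [|q qP wq] := eqv_stab_word wJ; first by rewrite wactE w1 mul1mx.
have [u [v [uU vL Hq]]] := stab_decomposition qP.
have uv1 : wval u *m wval v = 1%:M by rewrite -val_cat -(eqv_wval Hq) -(eqv_wval wq).
have vE : wval v = wval (winv u).
  by rewrite -[LHS]mul1mx -(val_winvl u) -mulmxA uv1 mulmx1.
have v1 : wval v = 1%:M.
  apply/matrixP => i j; case: (eqVneq i p) => [->|ip]; first by rewrite L_row.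
  by rewrite vE translation_row // translation_inv.
rewrite wq Hq (IH v) // cats0; apply: translation_trivial => //.
by rewrite -uv1 v1 mulmx1.
Qed.

Definition supported_mx (K : {set 'I_n}) (g : 'M[int]_n) :=
  forall i j, (i \notin K) || (j \notin K) -> g i j = (i == j)%:R.

(** Column p of [g] is e_p, so multiplying by [X c p k] on the right changes the entry (p, k) by one
    and nothing else. Once row p is cleared in this way, what remains is supported on J without
    p. *)
Lemma stab_generation_step :
  (forall g, g \in unitmx -> supported_mx (J :\ p) g -> exists2 w, all L w & wval w = g) ->
  forall g, g \in unitmx -> supported_mx J g -> (forall i, g i p = (i == p)%:R) ->
  exists2 w, all P w & wval w = g.
Proof.
move=> IH g; have [m] := ubnP (\sum_(k | k != p) `|g p k|%N)%N.
elim: m g => // m IHm g lt gU gJ gp.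
have [[k [kp gk]]|g0] := boolp.pselect (exists k, k != p /\ g p k != 0); last first.
  have [|w wL wg] := IH g gU; last first.
    by exists w => //; apply: sub_all wL => a; rewrite stab_letterE orbC => ->.
  move=> i j; rewrite !in_setD1 !negb_and !negbK -orbA => /or4P[/eqP->|iJ|/eqP->|jJ].
  - case: (eqVneq j p) => [->|jp]; first by rewrite gp eqxx.
    apply/eqP/negPn/negP => gj.
    by apply: g0; exists j.
  - by rewrite gJ ?iJ.
  - by rewrite gp.
  - by rewrite gJ ?jJ ?orbT.
have pk : p != k by rewrite eq_sym.
have kJ : k \in J.
  by apply: contraNT gk => kJ; rewrite gJ ?kJ ?orbT // (negbTE pk).
pose c := g p k < 0.
have g2E i j : (g *m wval [:: X c p k]) i j = g i j + (j == k)%:R * (-1) ^+ (~~ c) * g i p.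
  have -> : wval [:: X c p k] = 1%:M + (-1) ^+ (~~ c) *: delta_mx p k.
    apply/matrixP => x y; rewrite !mxE pk andbT.
    case: (eqVneq x p) => [->|xp]; last by rewrite mulr0 addr0.
    by rewrite (eq_sym y); case: c; rewrite /= ?expr0 ?expr1 ?mul1r ?mulN1r.
  rewrite mulmxDr mulmx1 mxE; congr (_ + _); rewrite mxE (bigD1 p) //= big1 ?addr0.
    rewrite !mxE eqxx mulrC -mulrA (mulrC (_ ^+ _)) mulrA.
    by case: eqP => _; rewrite ?mulr0 ?mul0r ?mulr1 ?mul1r // mulrC.
  by move=> l lp; rewrite !mxE (negbTE lp) mulr0 mulr0.
have [||||w wP wg] := IHm (g *m wval [:: X c p k]).
- move: lt; rewrite ltnS; apply: leq_trans.
  rewrite (bigD1 k) //= [Y in (_ < Y)%N](bigD1 k) //= -addSn; apply: leq_add; last first.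
    apply/eq_leq/eq_bigr => l /andP[_ lk].
    by rewrite g2E (negbTE lk) !mul0r addr0.
  by move: gk; rewrite g2E eqxx gp eqxx /c; case: ltrP => /=; rewrite ?expr0 ?expr1; lia_numeric.
- by rewrite unitmx_mul gU val_unit.
- move=> i j ij; rewrite g2E gJ // gp; case: (eqVneq j k) ij => [->|_ _]; last by rewrite !mul0r addr0.
  rewrite kJ orbF => iJ; have /negbTE-> : i != p by apply: contraNneq iJ => ->.
  by rewrite mulr0 addr0.
- by move=> i; rewrite g2E (negbTE pk) !mul0r addr0.
exists (w ++ [:: X (~~ c) p k]).
  by rewrite all_cat wP /= /stab_letter /= pJ kJ kp.
rewrite val_cat wg -mulmxA -val_cat /=.
have /relators_wval : ([:: X c p k; X (~~ c) p k], [::]) \in @relators n.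
  by apply: mem_relators; have := relator_XX (~~ c) p k; rewrite negbK.
by rewrite /= => ->; rewrite mulmx1.
Qed.

Lemma wact_base i : wact (base i) (delta_mx p 0) = delta_mx i 0 :> 'cV[int]_n.
Proof.
apply/matrixP => x y; rewrite ord1 !mxE !eqxx !andbT /swap.
case: (eqVneq x i) => [_|xi]; rewrite ?eqxx //.
case: (eqVneq x p) xi => [->|xp _]; last by rewrite (negbTE xp).
by rewrite eq_sym => /negbTE->.
Qed.

(** Stripping the section word of column p off [g] leaves an invertible matrix with column p equal
    to d e_p; invertibility forces d = 1. *)
Lemma generation_step :
  (forall g, g \in unitmx -> supported_mx (J :\ p) g -> exists2 w, all L w & wval w = g) ->
  forall g, g \in unitmx -> supported_mx J g ->
  exists2 w, all (letter_in J) w & wval w = g.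
Proof.
move=> IH g gU gJ.
pose v : 'cV[int]_n := col p g.
have vJ : supported J v.
  move=> k kJ; rewrite mxE gJ ?kJ //.
  by case: eqVneq kJ => // ->; rewrite pJ.
have gpU : invmx g *m v = delta_mx p 0.
  by rewrite /v colE mulmxA mulVmx // mul1mx.
have v0 : v != 0 by apply: contraNneq delta_neq0 => v0; rewrite -gpU v0 mulmx0.
have [||sJ [d d0 vd]] := @section_val n J base (delta_mx p 0) _ _ v vJ v0.
- by move=> i iJ; rewrite /= iJ pJ.
- by move=> i iJ; rewrite wact_base.
set s := section _ _ _ in sJ vd.
pose h := wval (winv s) *m g.
have hU : h \in unitmx by rewrite unitmx_mul val_unit.
have hp i : h i p = d%:Z * (i == p)%:R.
  have : h *m delta_mx p 0 = d%:Z *: (delta_mx p 0 : 'cV[int]_n).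
    rewrite /h -mulmxA -[g *m _]colE -/v vd -scalemxAr wactE mulmxA val_winvl.
    by rewrite mul1mx.
  move=> /matrixP/(_ i ord0); rewrite -colE !mxE eqxx andbT; exact.
have d1 : d = 1%N.
  have /matrixP/(_ p p) := mulVmx hU; rewrite mxE (bigD1 p) //= big1 => [|i ip].
    rewrite addr0 hp eqxx mulr1 mxE eqxx => /(congr1 absz); rewrite abszM /= => /eqP.
    by rewrite muln_eq1 => /andP[_ /eqP].
  by rewrite hp (negbTE ip) !mulr0.
have hJ : supported_mx J h.
  rewrite /h -wactE; have : all (letter_in J) (winv s).
    by rewrite all_winv // => -[[[b i] j]|a].
  elim: (winv s) => //= a w IHw /andP[aJ /IHw{}IHw] i j ij.
  case: a aJ => [[[b x] y]|[x|[x y]]] /=; rewrite mxE.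
  - move=> /andP[xJ yJ]; rewrite !(IHw i) //; case: (eqVneq i x) => //= ix.
    case: (eqVneq x y) => //= xy; subst x; move: ij; rewrite xJ /= => jJ.
    rewrite IHw ?jJ ?orbT //; have /negbTE-> : y != j by apply: contraNneq jJ => <-.
    by case: b; rewrite ?addr0 ?subr0.
  - move=> xJ; rewrite IHw //; case: eqVneq => // ix; subst x; move: ij; rewrite xJ /= => jJ.
    have /negbTE-> : i != j by apply: contraNneq jJ => <-.
    by rewrite oppr0.
  - have notin z : j \notin J -> z \in J -> (z == j) = false.
      by move=> jJ zJ; apply/negbTE; apply: contraNneq jJ => <-.
    move=> /andP[xJ yJ]; rewrite /swap; case: (eqVneq i x) => [ix|ix].
      subst x; move: ij; rewrite xJ /= => jJ; rewrite IHw ?jJ ?orbT //.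
      by rewrite !notin.
    case: (eqVneq i y) => [iy|iy]; last by rewrite IHw.
    subst y; move: ij; rewrite yJ /= => jJ; rewrite IHw ?jJ ?orbT //.
    by rewrite !notin.
have hp1 i : h i p = (i == p)%:R by rewrite hp d1 mul1r.
have [w wP wh] := stab_generation_step IH hU hJ hp1.
exists (s ++ w); first by rewrite all_cat sJ; apply: sub_all wP => a /andP[].
by rewrite val_cat wh /h mulmxA val_winvr mul1mx.
Qed.

End Step.

Local Open Scope ring_scope.

Let letter_in0 w : all (letter_in set0) w -> w = [::].
Proof. by case: w => // -[[[b i] j]|[i|[i j]]] w /=; rewrite !in_set0. Qed.

Lemma eqv_trivial_in J w : all (letter_in J) w -> wval w = 1%:M -> w ~ [::].
Proof.
have [m] := ubnP #|J|; elim: m J w => // m IHm J w lt.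
case: (set_0Vmem J) => [->|[p pJ]]; first by move=> /letter_in0-> _; reflexivity.
apply: (eqv_trivial_step pJ) => u; apply: IHm.
by move: lt; rewrite (cardsD1 p J) pJ.
Qed.

Lemma generation_in J g : g \in unitmx -> supported_mx J g ->
  exists2 w, all (letter_in J) w & wval w = g.
Proof.
have [m] := ubnP #|J|; elim: m J g => // m IHm J g lt.
case: (set_0Vmem J) => [->|[p pJ]].
  move=> _ g1; exists [::] => //; apply/matrixP => i j.
  by rewrite g1 ?in_set0 // mxE.
apply: (generation_step pJ) => h; apply: IHm.
by move: lt; rewrite (cardsD1 p J) pJ.
Qed.

Let letter_inT w : all (letter_in setT) w.
Proof. by apply/allP => -[[[b i] j]|[i|[i j]]] _ /=; rewrite !in_setT. Qed.

Let supportedT g : supported_mx setT g.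
Proof. by move=> i j; rewrite !in_setT. Qed.

Theorem presentation u w : wval u = wval w -> u ~ w.
Proof.
move=> uw; have H : u ++ winv w ~ [::].
  by apply: (eqv_trivial_in (letter_inT _)); rewrite val_cat uw val_winvr.
by rewrite -[u]cats0 -(eqv_winvl w) catA H; reflexivity.
Qed.

Theorem generation g : g \in unitmx -> exists w, wval w = g.
Proof. by move=> /generation_in/(_ (@supportedT g))[w _ <-]; exists w. Qed.

Theorem stab_generation p g : g \in unitmx -> (forall i, g i p = (i == p)%:R) ->
  exists2 w, all (stab_letter setT p) w & wval w = g.
Proof.
move=> gU gp; apply: (stab_generation_step (in_setT p)) => //.
by move=> h; apply: generation_in.
Qed.

End Presentation.

Lemma primitive_decomposition n (p : 'I_n) (v : 'cV[int]_n) : v != 0%R ->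
  exists2 d : nat, 0 < d & exists w, v = (d%:Z *: (wval w *m delta_mx p 0))%R.
Proof.
move=> v0; have [|||_ [d d0 vE]] := @section_val n setT (base p) (delta_mx p 0%R) _ _ v _ v0.
- by move=> i iJ; rewrite /= !in_setT.
- by move=> i iJ; rewrite wact_base.
- by move=> k; rewrite in_setT.
by exists d => //; exists (section setT (base p) v); rewrite -wactE.
Qed.

(** * Certificates *)

(** Certificates use triples of numbers instead of [letter], so that every number decodes to some
    certificate; triples that are no letters are rejected in words and have no effect in tables. The
    first component is the kind: 0 and 1 for adding and subtracting a row, 2 for a sign change, 3
    for a transposition. *)
Definition lcode : Type := (nat * nat * nat)%type.

Definition linvc (c : lcode) : lcode :=
  (if c.1.1 == 0 then 1 else if c.1.1 == 1 then 0 else c.1.1, c.1.2, c.2).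

Definition winvc (w : seq lcode) : seq lcode := rev [seq linvc c | c <- w].

Definition table : Type := seq (lcode * nat * nat).

(** A missing entry reads as 0. This is safe because the tests examine the values of [lookup] and
    not the list behind them. *)
Definition lookup (tab : table) (c : lcode) (x : nat) : nat :=
  foldr (fun (e : lcode * nat * nat) (y : nat) => if e.1 == (c, x) then e.2 else y) 0 tab.

Definition pact (tab : table) (w : seq lcode) (x : nat) : nat := foldr (lookup tab) x w.

Lemma pact_cat tab u w x : pact tab (u ++ w) x = pact tab u (pact tab w x).
Proof. exact: foldr_cat. Qed.

Lemma lookup_graph (f : lcode -> nat -> nat) (ks : seq (lcode * nat)) c x :
  (c, x) \in ks -> lookup [seq (k, f k.1 k.2) | k <- ks] c x = f c x.
Proof.
elim: ks => //= k ks IHks; rewrite inE eq_sym /lookup /=.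
by case: eqVneq => [->|_] //=; apply: IHks.
Qed.

(** Generators are named by position, so that an output word consists literally of members of S and
    their inverses. An invalid position would give the empty word and is excluded by
    [valid_word]. *)
Definition sletter (ws : seq (seq lcode)) (kb : nat * nat) : seq lcode :=
  if kb.2 == 0 then nth [::] ws kb.1 else winvc (nth [::] ws kb.1).

Definition expand (ws : seq (seq lcode)) (sw : seq (nat * nat)) : seq lcode :=
  flatten [seq sletter ws kb | kb <- sw].

Definition entry (A : seq (seq int)) (r c : nat) : int := nth 0%R (nth [::] A r) c.

Section Dimension.
Variable m : nat.
Local Notation n := m.+1.
Local Notation letter := (letter n).
Local Notation word := (seq letter).
Implicit Types (a : letter) (u w : word).

Definition mxl (T : Type) p q (A : 'M[T]_(p, q)) : seq (seq T) :=
  [seq [seq A i j | j <- enum 'I_q] | i <- enum 'I_p].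

Definition mklist (f : nat -> nat -> int) : seq (seq int) :=
  [seq [seq f r c | c <- iota 0 n] | r <- iota 0 n].

Definition lactc (c : lcode) (A : seq (seq int)) : seq (seq int) :=
  let k := c.1.1 in let i := c.1.2 in let j := c.2 in
  mklist (fun r s =>
    if k == 0 then
      if (r == i) && (i != j) then (entry A r s + entry A j s)%R else entry A r s
    else if k == 1 then
      if (r == i) && (i != j) then (entry A r s + - entry A j s)%R else entry A r s
    else if k == 2 then if r == i then (- entry A r s)%R else entry A r s
    else entry A (if r == i then j else if r == j then i else r) s).

Definition evalc (w : seq lcode) : seq (seq int) := foldr lactc (mxl (1%:M : 'M[int]_n)) w.

Definition encl a : lcode :=
  match a with
  | X b i j => (if b then 0 else 1, val i, val j)
  | E i => (2, val i, 0)
  | T i j => (3, val i, val j)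
  end.
Definition encw w : seq lcode := [seq encl a | a <- w].

Definition alphabet : seq lcode := [seq encl a | a <- enum {: letter}].
Definition stab_alphabet : seq lcode :=
  [seq encl a | a <- enum {: letter} & stab_letter setT ord0 a].
Definition relations : seq (seq lcode * seq lcode) :=
  [seq (encw q.1, encw q.2) | q <- relators n].

Lemma encl_inj : injective encl.
Proof.
case=> [[[b i] j]|[i|[i j]]] [[[c k] l]|[k|[k l]]] //=; try by case: b.
- by case: b; case: c => // -[/val_inj-> /val_inj->].
- by case: c.
- by case=> /val_inj->.
- by case: c.
- by case=> /val_inj-> /val_inj->.
Qed.

Lemma linvc_encl a : linvc (encl a) = encl (linv a).
Proof. by case: a => [[[[] i] j]|[i|[i j]]]. Qed.

Lemma winvc_encw w : winvc (encw w) = encw (winv w).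
Proof.
rewrite /winvc /winv /encw map_rev -!map_comp; congr rev.
by apply: eq_map => a; apply: linvc_encl.
Qed.

Lemma encw_cat u w : encw (u ++ w) = encw u ++ encw w.
Proof. exact: map_cat. Qed.

Lemma mem_alphabet a : encl a \in alphabet.
Proof. by apply: map_f; rewrite mem_enum. Qed.

Lemma alphabetP (l : seq lcode) : all (mem alphabet) l -> exists w, l = encw w.
Proof.
elim: l => [|c l IHl] /=; first by exists [::].
by move=> /andP[/mapP[a _ ->] /IHl[w ->]]; exists (a :: w).
Qed.

Lemma all_alphabet w : all (mem alphabet) (encw w).
Proof. by apply/allP => _ /mapP[a _ ->]; apply: mem_alphabet. Qed.

Lemma stab_alphabetP (l : seq lcode) : all (mem stab_alphabet) l ->
  exists2 w, all (stab_letter setT ord0) w & l = encw w.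
Proof.
elim: l => [|c l IHl] /=; first by exists [::].
move=> /andP[/mapP[a]]; rewrite mem_filter => /andP[aP _] -> /IHl[w wP ->].
by exists (a :: w); rewrite /= ?aP.
Qed.

Lemma mem_stab_alphabet a : stab_letter setT ord0 a -> encl a \in stab_alphabet.
Proof. by move=> aP; apply: map_f; rewrite mem_filter aP mem_enum. Qed.

Lemma all_stab_alphabet w : all (stab_letter setT ord0) w -> all (mem stab_alphabet) (encw w).
Proof. by move/allP => wP; apply/allP => _ /mapP[a /wP aP ->]; apply: mem_stab_alphabet. Qed.

Lemma words_codesP (ls : seq (seq lcode)) : all (all (mem alphabet)) ls ->
  exists ws, ls = map encw ws.
Proof.
elim: ls => [|l ls IHls] /=; first by exists [::].
by move=> /andP[/alphabetP[w ->] /IHls[ws ->]]; exists (w :: ws).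
Qed.

Lemma nth_mxl (T : Type) (d : T) p q (A : 'M[T]_(p, q)) (i : 'I_p) (j : 'I_q) :
  nth d (nth [::] (mxl A) i) j = A i j.
Proof.
rewrite (nth_map i) ?size_enum_ord // (nth_map j) ?size_enum_ord //.
by rewrite !nth_ord_enum.
Qed.

Lemma mxl_inj (T : eqType) p q : injective (@mxl T p q).
Proof.
move=> A B AB; apply/matrixP => i j.
by rewrite -(nth_mxl (A i j) A) -(nth_mxl (A i j) B) AB.
Qed.

Lemma mklistE (f : nat -> nat -> int) (A : 'M[int]_n) :
  (forall i j : 'I_n, f i j = A i j) -> mklist f = mxl A.
Proof.
move=> fA; rewrite /mklist /mxl -val_enum_ord -map_comp; apply: eq_map => i /=.
by rewrite -map_comp; apply: eq_map => j /=.
Qed.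

Lemma lactc_encl a (A : 'M[int]_n) : lactc (encl a) (mxl A) = mxl (lact a A).
Proof.
apply: mklistE => i j.
case: a => [[[b k] l]|[k|[k l]]] /=; rewrite mxE /entry.
- by case: b => /=; rewrite !nth_mxl.
- by rewrite !nth_mxl.
- rewrite -[nat_of_ord i == _]/(i == k) -[nat_of_ord i == _]/(i == l) /swap.
  by case: (i == k); [|case: (i == l)]; rewrite nth_mxl.
Qed.

Lemma evalc_encw w : evalc (encw w) = mxl (wval w).
Proof.
elim: w => //= a w IHw.
by rewrite /evalc /= -/(evalc (encw w)) IHw lactc_encl val_cons.
Qed.

(** Nothing is required outside of [D]. That the letters permute [D] follows from the test, since
    each has an inverse letter and the cancellation of the two is among the relations. *)
Definition tabok (tab : table) (D : seq nat) : bool :=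
  [&& 0 \in D,
      all (fun c => all (fun x => lookup tab c x \in D) D) alphabet
    & all (fun q => all (fun x => pact tab q.1 x == pact tab q.2 x) D) relations].

Lemma tabok_eqv tab D u w : tabok tab D -> eqv u w -> forall x, x \in D ->
  pact tab (encw u) x = pact tab (encw w) x.
Proof.
move=> /and3P[_ /allP closed /allP rel].
have stable t x : x \in D -> pact tab (encw t) x \in D.
  move=> xD; elim: t => //= a t IHt.
  exact: (allP (closed _ (mem_alphabet a))).
elim=> {u w} [//|u w _ IH|u w t _ IH1 _ IH2|a u w _ IH|u w t r] x xD.
- by rewrite IH.
- by rewrite IH1 ?IH2.
- by rewrite /pact /= -!/(pact _ _ _) IH.
- rewrite !encw_cat !pact_cat.
  have /rel/allP H : (encw u, encw w) \in relations.
    by apply/mapP; exists (u, w) => //; apply: mem_relators.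
  exact/eqP/H/stable.
Qed.

Section Soundness.
Variables (ws : seq word) (tab : table) (D : seq nat).
Hypothesis tab_ok : tabok tab D.
Hypothesis fix0 : all (fun w => pact tab (encw w) 0 == 0) ws.

Let D0 : 0 \in D. Proof. by case/and3P: tab_ok. Qed.

(** By induction every element of H has some word that fixes 0, and by [presentation] any other word
    of the same value acts on [D] in the same way. *)
Lemma generated_fix w : generated [seq wval w | w <- ws] (wval w) -> pact tab (encw w) 0 = 0.
Proof.
suff H g : generated [seq wval w | w <- ws] g -> exists2 u, wval u = g & pact tab (encw u) 0 = 0.
  by move=> /H[u /presentation/(tabok_eqv tab_ok) uw u0]; rewrite -uw.
elim=> {g} [|_ /mapP[u uws ->]|_ _ _ [u <- u0] _ [v <- v0]|_ _ [u <- u0]].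
- by exists [::].
- by exists u => //; apply/eqP/(allP fix0).
- by exists (u ++ v); rewrite ?val_cat // encw_cat pact_cat v0.
- exists (winv u); first by rewrite val_winv.
  rewrite -{1}u0 -pact_cat -encw_cat.
  by rewrite (tabok_eqv tab_ok (eqv_winvl u)).
Qed.

End Soundness.

(** * The coset table of a subgroup of finite index *)

Section Cosets.
Variable S : seq 'M[int]_n.
Hypothesis S_sl : {in S, forall s, SLZ s}.
Hypothesis S_index : finite_index S.
Local Notation H := (generated S).
Local Open Scope ring_scope.

Lemma generated_det g : H g -> \det g = 1.
Proof.
elim=> {g} [|g /S_sl //|g h _ g1 _ h1|g _ g1].
- exact: det1.
- by rewrite det_mulmx g1 h1 mulr1.
- by rewrite det_inv g1 invr1.
Qed.

Lemma generated_unit g : H g -> g \in unitmx.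
Proof. by rewrite unitmxE => /generated_det->; apply: unitr1. Qed.

(** Determinants are 1 or -1 here; if -1 occurs, one fixed matrix of that determinant carries the
    second half of the group into SL, so that twice as many representatives suffice. *)
Lemma unimodular_cover : exists2 Ts : seq 'M[int]_n, {in Ts, forall t, t \in unitmx} &
  forall g, g \in unitmx -> exists t h, [/\ t \in Ts, H h & g = t *m h].
Proof.
have [T0 T0sl cov] := S_index.
have sl_unit g : SLZ g -> g \in unitmx by rewrite unitmxE => ->; apply: unitr1.
have [[g1 [g1U d1]]|no] := boolp.pselect (exists g1 : 'M[int]_n, g1 \in unitmx /\ \det g1 <> 1).
  have detN (g : 'M[int]_n) : g \in unitmx -> \det g <> 1 -> \det g = -1.
    move=> gU; have e : \det g * \det (invmx g) = 1.
      by rewrite -det_mulmx mulmxV // det1.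
    have /eqP := congr1 absz e; rewrite abszM muln_eq1 => /andP[/eqP].
    by case: (\det g) => k /=; lia.
  exists (T0 ++ [seq invmx g1 *m t | t <- T0]).
    move=> t; rewrite mem_cat => /orP[/T0sl/sl_unit//|/mapP[t' /T0sl/sl_unit t'U ->]].
    by rewrite unitmx_mul unitmx_inv g1U.
  move=> g gU; have [d|d] := boolp.pselect (\det g = 1).
    by have [t [h [tT Hh ->]]] := cov g d; exists t, h; rewrite mem_cat tT.
  have [|t [h [tT Hh E1]]] := cov (g1 *m g).
    by rewrite /SLZ det_mulmx (detN g1) // (detN g) // mulrNN mulr1.
  exists (invmx g1 *m t), h; split=> //; first by rewrite mem_cat map_f ?orbT.
  by rewrite -mulmxA -E1 mulmxA mulVmx ?mul1mx.
exists T0; first by move=> t /T0sl/sl_unit.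
move=> g gU; apply: cov; have [//|d] := boolp.pselect (\det g = 1).
by case: no; exists g.
Qed.

Lemma coset_table : exists tab D (ci : 'M[int]_n -> nat),
  [/\ tabok tab D,
      forall w g, g \in unitmx -> pact tab (encw w) (ci g) = ci (wval w *m g),
      forall g, g \in unitmx -> ci g \in D,
      ci 1%:M = 0%N
    & forall g g', g \in unitmx -> g' \in unitmx ->
        ci g = ci g' <-> exists2 h, H h & g' = g *m h].
Proof.
have [T0 T0U T0cov] := unimodular_cover.
(* With the identity in front, [find] gives the coset H the number 0. Repeated representatives do no
   harm, as only the first of a coset is ever found. *)
pose Ts := 1%:M :: T0.
have TsU t : t \in Ts -> t \in unitmx.
  by rewrite inE => /predU1P[->|/T0U//]; apply: unitmx1.
(* Membership in a coset is decided classically, since the table is only claimed to exist. *)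
pose coset (t g : 'M[int]_n) := boolp.asbool (exists2 h, H h & g = t *m h).
have cosetP t g : reflect (exists2 h, H h & g = t *m h) (coset t g) by apply: boolp.asboolP.
have coset_mulr t g h : H h -> coset t (g *m h) = coset t g.
  move=> Hh; apply/cosetP/cosetP => -[k Hk gk].
    exists (k *m invmx h); first by apply: GenMul => //; apply: GenInv.
    by rewrite mulmxA -gk -mulmxA mulmxV ?mulmx1 // generated_unit.
  by exists (k *m h); [apply: GenMul | rewrite gk mulmxA].
pose ci g := find (fun t => coset t g) Ts.
have ci_has g : g \in unitmx -> has (fun t => coset t g) Ts.
  move=> gU; have [t [h [tT Hh ->]]] := T0cov g gU.
  by apply/hasP; exists t; [rewrite inE tT orbT | apply/cosetP; exists h].
pose rep x := nth 1%:M Ts x.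
have repP g : g \in unitmx -> exists2 h, H h & g = rep (ci g) *m h.
  by move=> gU; apply/cosetP; exact: (nth_find 1%:M (ci_has g gU)).
have repU x : rep x \in unitmx.
  have [lt|ge] := ltnP x (size Ts); first exact/TsU/mem_nth.
  by rewrite /rep nth_default // unitmx1.
have ci_mulr g h : H h -> ci (g *m h) = ci g.
  by move=> Hh; apply: eq_find => t; apply: coset_mulr.
have ciP g g' : g \in unitmx -> g' \in unitmx -> ci g = ci g' <-> exists2 h, H h & g' = g *m h.
  move=> gU g'U; split=> [e|[h Hh ->]]; last by rewrite ci_mulr.
  have [h Hh gE] := repP g gU; have [h' Hh' g'E] := repP g' g'U.
  exists (invmx h *m h'); first by apply: GenMul => //; apply: GenInv.
  by rewrite g'E -e {2}gE mulmxA mulmxK // generated_unit.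
have lactE a (g : 'M[int]_n) : lact a g = wval [:: a] *m g by rewrite -wactE.
have wvalU a : wval [:: a] \in unitmx by apply: val_unit.
pose f (c : lcode) x := if [pick a | encl a == c] is Some a then ci (lact a (rep x)) else 0%N.
have fE a g : g \in unitmx -> f (encl a) (ci g) = ci (lact a g).
  move=> gU; rewrite /f; case: pickP => [b /eqP/encl_inj->|/(_ a)]; last by rewrite eqxx.
  by have [h Hh {2}->] := repP g gU; rewrite lactM ci_mulr.
pose D := [seq ci t | t <- Ts].
have inD g : g \in unitmx -> ci g \in D.
  move=> gU; have [t [h [tT Hh ->]]] := T0cov g gU.
  by rewrite ci_mulr // map_f // inE tT orbT.
have DP x : x \in D -> exists2 g, g \in unitmx & x = ci g.
  by move=> /mapP[t /TsU tU ->]; exists t.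
pose tab := [seq (k, f k.1 k.2) | k <- [seq (c, x) | c <- alphabet, x <- D]] : table.
have tabE a g : g \in unitmx -> lookup tab (encl a) (ci g) = ci (lact a g).
  move=> gU; rewrite lookup_graph ?fE //.
  by apply/allpairsP; exists (encl a, ci g); rewrite mem_alphabet inD.
have pactE w g : g \in unitmx -> pact tab (encw w) (ci g) = ci (wval w *m g).
  move=> gU; elim: w => [|a w IHw]; first by rewrite mul1mx.
  rewrite /pact /= -/(pact _ _ _) IHw tabE; last by rewrite unitmx_mul val_unit.
  by rewrite lactM.
exists tab, D, ci; split=> //; last first.
  rewrite /ci /=; suff -> : coset 1%:M 1%:M by [].
  by apply/cosetP; exists 1%:M; [apply: Gen1 | rewrite mul1mx].
apply/and3P; split.
- have <- : ci 1%:M = 0%N.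
    rewrite /ci /=; suff -> : coset 1%:M 1%:M by [].
    by apply/cosetP; exists 1%:M; [apply: Gen1 | rewrite mul1mx].
  exact/inD/unitmx1.
- apply/allP => _ /mapP[a _ ->]; apply/allP => _ /DP[g gU ->].
  by rewrite tabE // inD // lactE unitmx_mul wvalU.
- apply/allP => _ /mapP[[u w] /relators_wval uw ->]; apply/allP => _ /DP[g gU ->].
  by rewrite !pactE // uw.
Qed.

End Cosets.
End Dimension.

Lemma list_choice (K V : eqType) (R : K -> V -> Prop) (ks : seq K) :
  (forall k, k \in ks -> exists v, R k v) ->
  exists vs : seq V, (forall k, k \in ks -> exists2 v, v \in vs & R k v) /\
             (forall v, v \in vs -> exists2 k, k \in ks & R k v).
Proof.
elim: ks => [|k ks IHks] H; first by exists [::].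
have [v Rkv] := H k (mem_head _ _).
have [|vs [H1 H2]] := IHks; first by move=> x xks; apply: H; rewrite inE xks orbT.
exists (v :: vs); split=> x; rewrite inE => /predU1P[->|xin].
- by exists v; rewrite ?mem_head.
- by have [y yvs Rxy] := H1 x xin; exists y; rewrite // inE yvs orbT.
- by exists k; rewrite ?mem_head.
- by have [y yks Ryx] := H2 x xin; exists y; rewrite // inE yks orbT.
Qed.

(** * Words over the generators and the action on rational vectors *)

Section Action.
Variable n : nat.
Implicit Types (g h : 'M[int]_n) (u : 'cV[rat]_n).
Local Open Scope ring_scope.

Lemma act_mul g h u : act (g *m h) u = act g (act h u).
Proof. by rewrite /act map_mxM mulmxA. Qed.

Lemma act_one u : act 1%:M u = u.
Proof. by rewrite /act map_mx1 mul1mx. Qed.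

Lemma act_inv g u v : g \in unitmx -> act g u = v -> act (invmx g) v = u.
Proof. by move=> gU <-; rewrite -act_mul mulVmx ?act_one. Qed.

End Action.

Section Checkers.
Variable m : nat.
Local Notation n := m.+1.
Local Notation letter := (letter n).
Local Notation word := (seq letter).
Implicit Types (a : letter) (u w t : word) (ws : seq word) (sw : seq (nat * nat)).

Definition sletter_word ws (kb : nat * nat) : word :=
  if kb.2 == 0 then nth [::] ws kb.1 else winv (nth [::] ws kb.1).
Definition expand_word ws sw : word := flatten [seq sletter_word ws kb | kb <- sw].
Definition word_mx ws sw : seq 'M[int]_n := [seq wval (sletter_word ws kb) | kb <- sw].

Lemma nth_encw ws k : nth [::] (map (@encw m) ws) k = encw (nth [::] ws k).
Proof.
have [lt|ge] := ltnP k (size ws); first exact: nth_map.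
by rewrite !nth_default ?size_map.
Qed.

Lemma sletter_encw ws kb : sletter (map (@encw m) ws) kb = encw (sletter_word ws kb).
Proof. by rewrite /sletter /sletter_word nth_encw winvc_encw; case: ifP. Qed.

Lemma expand_encw ws sw : expand (map (@encw m) ws) sw = encw (expand_word ws sw).
Proof.
rewrite /expand /expand_word; elim: sw => //= kb sw ->.
by rewrite sletter_encw encw_cat.
Qed.

Lemma word_val_mx ws sw : word_val (word_mx ws sw) = wval (expand_word ws sw).
Proof. by elim: sw => //= kb sw IHsw; rewrite val_cat -IHsw. Qed.

Definition valid_word (p : nat) sw := all (fun kb => kb.1 < p) sw.

Lemma valid_is_word ws sw : valid_word (size ws) sw ->
  is_word [seq wval w | w <- ws] (word_mx ws sw).
Proof.
move=> /allP ok _ /mapP[kb /ok lt ->]; rewrite mem_cat /sletter_word; case: ifP => _.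
  by rewrite map_f ?mem_nth.
by rewrite val_winv map_f ?orbT // map_f ?mem_nth.
Qed.

Lemma is_word_generated (S s : seq 'M[int]_n) : is_word S s -> generated S (word_val s).
Proof.
elim: s => [_|g s IHs gs]; first exact: Gen1.
apply: GenMul; last by apply: IHs => x xs; apply: gs; rewrite inE xs orbT.
have := gs g (mem_head _ _); rewrite mem_cat => /orP[|/mapP[x xS ->]]; first exact: GenMem.
exact/GenInv/GenMem.
Qed.

Lemma valid_generated ws sw : valid_word (size ws) sw ->
  generated [seq wval w | w <- ws] (wval (expand_word ws sw)).
Proof. by move=> /valid_is_word/is_word_generated; rewrite word_val_mx. Qed.

Lemma generated_valid ws (g : 'M[int]_n) : generated [seq wval w | w <- ws] g ->
  exists2 sw, valid_word (size ws) sw & wval (expand_word ws sw) = g.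
Proof.
elim=> {g} [|_ /mapP[w wws ->]|_ _ _ [u uok <-] _ [v vok <-]|_ _ [u uok <-]].
- by exists [::].
- exists [:: (index w ws, 0)]; first by rewrite /valid_word /= index_mem wws.
  by rewrite /expand_word /= /sletter_word /= nth_index // cats0.
- exists (u ++ v); first by rewrite /valid_word all_cat; apply/andP.
  by rewrite /expand_word map_cat flatten_cat val_cat.
- exists (rev [seq (kb.1, (kb.2 == 0)%N : nat) | kb <- u]).
    by rewrite /valid_word all_rev all_map.
  rewrite -val_winv; congr wval; rewrite /expand_word.
  elim: u {uok} => //= kb u IHu.
  rewrite rev_cons map_rcons flatten_rcons IHu winv_cat; congr (_ ++ _).
  by rewrite /sletter_word /=; case: (kb.2 == 0); rewrite /= ?winvK.
Qed.

Local Open Scope ring_scope.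

Definition rat_at (v : seq (seq rat)) (i : nat) : rat := nth 0 (nth [::] v i) 0%N.

(* [v] is [a / (b + 1)] times the first column of the matrix of the word [g]. *)
Definition vecok (v : seq (seq rat)) (g : seq lcode) (p q : nat) : bool :=
  all (fun i => numq (rat_at v i) * q.+1%:Z ==
                denq (rat_at v i) * p%:Z * entry (evalc m g) i 0) (iota 0 n).

(** With [q.+1] as denominator, every pair of numbers in a certificate denotes a vector. *)
Definition axis (p q : nat) : 'cV[rat]_n := (p%:R / q.+1%:R) *: delta_mx 0 0.

Lemma act_axis (g : 'M[int]_n) p q i : act g (axis p q) i 0 = p%:R / q.+1%:R * (g i 0)%:~R.
Proof. by rewrite /act /axis -scalemxAr mxE -colE !mxE. Qed.

Lemma vecokP (v : 'cV[rat]_n) w p q :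
  reflect (v = act (wval w) (axis p q)) (vecok (mxl v) (encw w) p q).
Proof.
have q0 : q.+1%:R != 0 :> rat by rewrite pnatr_eq0.
have E1 (i : 'I_n) : (numq (v i 0) * q.+1%:Z == denq (v i 0) * p%:Z * wval w i 0) =
    (v i 0 == act (wval w) (axis p q) i 0).
  have d0 : (denq (v i 0))%:~R != 0 :> rat by rewrite intr_eq0 denq_neq0.
  rewrite act_axis -(eqr_int rat) !intrM numqE.
  rewrite -[(q.+1%:Z)%:~R]/(q.+1%:R : rat) -[(p%:Z)%:~R]/(p%:R : rat).
  move: (q.+1%:R : rat) q0 => b b0; apply/eqP/eqP => [e|->].
    by apply: (mulIf d0); apply: (mulIf b0); rewrite e; field.
  by field.
have E2 (i : 'I_n) : (numq (rat_at (mxl v) i) * q.+1%:Z ==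
    denq (rat_at (mxl v) i) * p%:Z * entry (evalc m (encw w)) i 0) =
    (v i 0 == act (wval w) (axis p q) i 0).
  by rewrite evalc_encw /entry /rat_at (nth_mxl 0 v i ord0) (nth_mxl 0 (wval w) i ord0).
apply: (iffP allP) => [H|vE i].
  apply/matrixP => i j; rewrite ord1; apply/eqP; rewrite -E2.
  by apply: H; rewrite mem_iota /= add0n.
rewrite mem_iota /= add0n => lt; rewrite -[i]/(nat_of_ord (Ordinal lt)) E2.
by rewrite -vE.
Qed.

Lemma axis0 q : axis 0 q = 0.
Proof. by rewrite /axis mul0r scale0r. Qed.

Lemma vecok_exists (v : 'cV[rat]_n) : exists w p q, vecok (mxl v) (encw w) p q.
Proof.
case: (eqVneq v 0) => [->|v0].
  by exists [::], 0%N, 0%N; apply/vecokP; rewrite axis0 /act mulmx0.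
pose B := \prod_i denq (v i 0).
have B0 : 0 < B by apply: prodr_gt0 => i _; apply: denq_gt0.
pose x : 'cV[int]_n := \col_i (numq (v i 0) * \prod_(j | j != i) denq (v j 0)).
have xE i : (x i 0)%:~R = v i 0 * B%:~R.
  rewrite mxE intrM numqE -mulrA -intrM; congr (_ * _%:~R).
  by rewrite /B [RHS](bigD1 i).
have x0 : x != 0.
  apply: contraNneq v0 => x0; apply/eqP/matrixP => i j; rewrite ord1.
  have := xE i; rewrite x0 !mxE => /esym/eqP.
  by rewrite mulf_eq0 intr_eq0 (gt_eqF B0) orbF => /eqP.
have [d d0 [w xw]] := primitive_decomposition ord0 x0.
(* The factor is d / B, where B clears the denominators of [v]; the predecessor makes [q.+1] equal
   to B. *)
exists w, d, `|B|.-1%N; apply/vecokP/matrixP => i j; rewrite ord1 act_axis.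
have BE : (`|B|.-1.+1%:R : rat) = B%:~R.
  by rewrite prednK ?absz_gt0 ?gt_eqF // natr_absz gtr0_norm.
have BN : B%:~R != 0 :> rat by rewrite intr_eq0 gt_eqF.
have xd : x i 0 = d%:Z * wval w i 0 by rewrite xw mxE -colE mxE.
apply: (mulIf BN); rewrite -xE BE xd intrM -[(d%:Z)%:~R]/(d%:R : rat).
by move: (B%:~R) BN => b b0; field.
Qed.

(* The entries in position (0, 0) of [g] and of its inverse are integers relating the
   two lengths, and lengths are nonnegative. *)
Lemma axis_orbit (g : 'M[int]_n) p q p' q' : g \in unitmx ->
  act g (axis p q) = axis p' q' -> (p * q'.+1 = p' * q.+1)%N.
Proof.
pose c x y : rat := x%:R / y.+1%:R.
have axisE x y : axis x y 0 0 = c x y by rewrite /axis !mxE mulr1.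
have q0 x : x.+1%:R != 0 :> rat by rewrite pnatr_eq0.
have c0 x y : 0 <= c x y by rewrite divr_ge0.
move=> gU H; have H' := act_inv gU H.
have /matrixP/(_ 0 0) := H; rewrite act_axis axisE -/(c p q) => E1.
have /matrixP/(_ 0 0) := H'; rewrite act_axis axisE -/(c p' q') => E2.
suff: c p q = c p' q'.
  by rewrite /c => /eqP; rewrite eqr_div // -!natrM eqr_nat => /eqP.
case: (eqVneq (c p q) 0) => [z|nz]; first by rewrite -E1 z mul0r.
set x := g 0 0 in E1; set y := invmx g 0 0 in E2.
have /eqP : c p q * (x * y)%:~R = c p q * 1 by rewrite intrM mulrA E1 mulr1.
rewrite (inj_eq (mulfI nz)) -[1]/(1%:~R) eqr_int => /eqP xy.
have x0 : 0 <= x.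
  have cp : 0 < c p q by rewrite lt_neqAle eq_sym nz c0.
  by have := c0 p' q'; rewrite -E1 (pmulr_rge0 _ cp) ler0z.
suff x1 : x = 1 by rewrite -E1 x1 mulr1.
have := congr1 absz xy; rewrite abszM => /eqP; rewrite muln_eq1 => /andP[/eqP]; lia.
Qed.

(** For p = 0 the axis vector is zero, and its stabilizer is the whole group. *)
Definition stab_codes (p : nat) : seq lcode := if p == 0%N then alphabet m else stab_alphabet m.

Lemma stab_codes_act p q w : all (mem (stab_codes p)) (encw w) ->
  act (wval w) (axis p q) = axis p q.
Proof.
rewrite /stab_codes; case: eqVneq => [->|p0]; first by rewrite axis0 /act mulmx0.
move=> /stab_alphabetP[w' wP /(inj_map (@encl_inj m)) ww']; rewrite {w}ww'.
rewrite /act /axis -scalemxAr; congr (_ *: _).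
have -> : delta_mx 0 0 = map_mx intr (delta_mx 0 0 : 'cV[int]_n) :> 'cV[rat]_n.
  by rewrite map_delta_mx.
rewrite -map_mxM -wactE; congr map_mx.
elim: w' wP => //= a w IHw /andP[/andP[_ aP] /IHw ->].
apply/matrixP => i j; case: a aP => [[[b k] l]|[k|[k l]]] /= => [l0|k0|/andP[k0 l0]];
  rewrite !mxE ord1.
- rewrite (negbTE l0) /= if_same; case: ifP => // _.
  by case: b; rewrite ?addr0 ?subr0.
- by case: eqVneq => // ->; rewrite (negbTE k0) oppr0.
- rewrite /swap; case: (eqVneq i k) => [->|ik]; first by rewrite (negbTE l0) (negbTE k0).
  by case: (eqVneq i l) => [->|//]; rewrite (negbTE l0) (negbTE k0).
Qed.

Lemma stab_codes_word p q (g : 'M[int]_n) : g \in unitmx ->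
  act g (axis p q) = axis p q ->
  exists2 w, all (mem (stab_codes p)) (encw w) & wval w = g.
Proof.
rewrite /stab_codes => gU; case: eqVneq => [_ _|p0 H].
  by have [w <-] := generation gU; exists w; rewrite ?all_alphabet.
have [|w wP <-] := @stab_generation n ord0 g gU; last first.
  by exists w; rewrite ?all_stab_alphabet.
move=> i; have /matrixP/(_ i 0) := H; rewrite act_axis /axis !mxE eqxx andbT => /eqP.
have c0 : p%:R / q.+1%:R != 0 :> rat by rewrite mulf_neq0 ?invr_eq0 ?pnatr_eq0.
rewrite (inj_eq (mulfI c0)) => /eqP e; apply/eqP; rewrite -(eqr_int rat) e.
by case: (i == _).
Qed.

End Checkers.

(** * The two tests, their soundness and completeness *)

Definition first_column (A : seq (seq int)) : seq int := [seq nth 0%R r 0 | r <- A].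

Section Decision.
Variable m : nat.
Local Notation n := m.+1.
Local Notation letter := (letter n).
Local Notation word := (seq letter).
Definition common_check (Sl : seq (seq (seq int))) (wsc : seq (seq lcode)) (tab : table)
    (D : seq nat) : bool :=
  [&& all (all (mem (alphabet m))) wsc, [seq evalc m w | w <- wsc] == Sl, tabok m tab D
    & all (fun w => pact tab w 0 == 0) wsc].

(* Tag [0]: the word [sw] maps [u] to [v]; tag [1]: [u] and [v] lie in different orbits of
   the full unimodular group; any other tag: [Y] separates their cosets. *)
Definition orbit_check (Sl : seq (seq (seq int))) (ul vl : seq (seq rat))
    (wsc : seq (seq lcode)) (tab : table) (D : seq nat) (gu gv : seq lcode)
    (pu pv : nat * nat) (tag : nat) (sw : seq (nat * nat)) (Y : seq nat) : bool :=
  [&& common_check Sl wsc tab D, all (mem (alphabet m)) gu, all (mem (alphabet m)) gv,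
      vecok m ul gu pu.1 pu.2, vecok m vl gv pv.1 pv.2 &
      if tag == 0 then
        [&& valid_word (size wsc) sw, pu == pv &
            first_column (evalc m (expand wsc sw ++ gu)) == first_column (evalc m gv)]
      else if tag == 1 then pu.1 * pv.2.+1 != pv.1 * pu.2.+1
      else
        [&& pu == pv, pact tab (winvc gu) 0 \in Y,
            all (fun c => all (fun y => lookup tab c y \in Y) Y) (stab_codes m pu.1) &
            pact tab (winvc gv) 0 \notin Y]].

(* [ts] is a transversal of the stabilizer of [axis] modulo the conjugate of the group
   generated by [W]; its nontrivial members are certified to lie outside of the subgroup. *)
Definition stab_check (Sl : seq (seq (seq int))) (ul : seq (seq rat))
    (wsc : seq (seq lcode)) (tab : table) (D : seq nat) (g : seq lcode)
    (pu : nat * nat) (ts : seq (seq lcode)) (W : seq (seq (nat * nat))) : bool :=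
  [&& common_check Sl wsc tab D, all (mem (alphabet m)) g, vecok m ul g pu.1 pu.2,
      all (valid_word (size wsc)) W, [::] \in ts &
  [&& all (all (mem (stab_codes m pu.1))) ts,
      all (fun t => all (fun c => has (fun t' => has (fun sw =>
        evalc m (g ++ winvc t' ++ c :: t ++ winvc g) == evalc m (expand wsc sw)) W) ts)
          (stab_codes m pu.1)) ts,
      all (fun sw => (pu.1 == 0) ||
        (first_column (evalc m (expand wsc sw ++ g)) == first_column (evalc m g))) W &
      all (fun t => (t == [::]) || (pact tab (g ++ t ++ winvc g) 0 != 0)) ts]].

Implicit Types (a : letter) (t w : word) (sw : seq (nat * nat)) (D Y : seq nat).
Implicit Types (u v : 'cV[rat]_n) (S : seq 'M[int]_n) (ws : seq word) (tab : table).

Lemma first_columnP (A B : 'M[int]_n) :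
  reflect (forall i, A i ord0 = B i ord0) (first_column (mxl A) == first_column (mxl B)).
Proof.
have E1 (C : 'M[int]_n) (i : 'I_n) : nth 0%R (first_column (mxl C)) i = C i ord0.
  by rewrite (nth_map [::]) ?(nth_mxl 0%R C i ord0) // size_map size_enum_ord.
have E2 (C : 'M[int]_n) : first_column (mxl C) = [seq C i ord0 | i <- enum 'I_n].
  rewrite /first_column /mxl -map_comp; apply: eq_map => i /=.
  by rewrite (nth_map ord0) ?size_enum_ord // (nth_ord_enum ord0 ord0).
apply: (iffP eqP) => [e i|e]; first by rewrite -E1 e E1.
by rewrite !E2; apply: eq_map.
Qed.

Lemma act_first_column (A B : 'M[int]_n) p q : (forall i, A i ord0 = B i ord0) ->
  act A (axis m p q) = act B (axis m p q).
Proof. by move=> e; apply/matrixP => i j; rewrite ord1 !act_axis e. Qed.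

Lemma first_column_act (A B : 'M[int]_n) p q : p != 0 ->
  act A (axis m p q) = act B (axis m p q) -> forall i, A i ord0 = B i ord0.
Proof.
move=> p0 e i; have /matrixP/(_ i ord0) := e; rewrite !act_axis => /eqP.
have c0 : (p%:R / q.+1%:R != 0 :> rat)%R.
  by rewrite mulf_neq0 ?invr_eq0 ?pnatr_eq0.
by rewrite (inj_eq (mulfI c0)) eqr_int => /eqP.
Qed.

Lemma common_checkP S wsc tab D : common_check [seq mxl s | s <- S] wsc tab D ->
  exists ws, [/\ wsc = map (@encw m) ws, S = [seq wval w | w <- ws], tabok m tab D
    & all (fun w => pact tab (encw w) 0 == 0) ws].
Proof.
move=> /and4P[/words_codesP[ws ->] /eqP E1 tabD fix0]; exists ws; split=> //.
  apply: (inj_map (@mxl_inj _ n n)); rewrite -E1 -!map_comp.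
  by apply: eq_map => w /=; rewrite evalc_encw.
by move: fix0; rewrite all_map.
Qed.

Lemma unit_words S : {in S, forall s, s \in unitmx} -> exists ws, S = [seq wval w | w <- ws].
Proof.
elim: S => [|s S IHS] SU; first by exists [::].
have [|ws ->] := IHS; first by move=> x xS; apply: SU; rewrite inE xS orbT.
by have [w <-] := generation (SU s (mem_head _ _)); exists (w :: ws).
Qed.

Lemma common_check_exists S : {in S, forall s, SLZ s} -> finite_index S ->
  exists ws tab D (ci : 'M[int]_n -> nat),
  [/\ S = [seq wval w | w <- ws],
      common_check [seq mxl s | s <- S] (map (@encw m) ws) tab D,
      forall w h, h \in unitmx -> pact tab (encw w) (ci h) = ci (wval w *m h)%R,
      forall h, h \in unitmx -> ci h \in D
    & [/\ ci 1%:M%R = 0, forall h, h \in unitmx -> ci h = 0 -> generated S h &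
      forall h h', h \in unitmx -> h' \in unitmx ->
        ci h = ci h' -> exists2 k, generated S k & h' = (h *m k)%R]].
Proof.
move=> Ssl Sind; have [tab [D [ci [tabD pactE inD ci1 ciP]]]] := coset_table Ssl Sind.
have gU := generated_unit Ssl.
have [|ws Sws] := @unit_words S; first by move=> s /GenMem/gU.
exists ws, tab, D, ci; split=> //.
- apply/and4P; split=> //.
  + by rewrite all_map; apply/allP => w _; apply: all_alphabet.
  + rewrite Sws -!map_comp; apply/eqP/eq_map => w /=; exact: evalc_encw.
  + rewrite all_map; apply/allP => w wws /=; rewrite -{1}ci1 pactE ?unitmx1 // mulmx1 -ci1.
    apply/eqP/esym/ciP; rewrite ?unitmx1 ?val_unit //; exists (wval w); rewrite ?mul1mx //.
    by apply: GenMem; rewrite Sws map_f.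
- split=> // [h hU|h h' hU h'U].
    rewrite -ci1 => /esym/ciP[]; rewrite ?unitmx1 // => k Hk ->; by rewrite mul1mx.
  by move/ciP; apply.
Qed.

(** An element h of H with h u = v gives w = g_v^-1 h g_u, which maps the axis vector of u to that
    of v. So the lengths agree, and w is a word in letters that fix the axis vector. As g_v w g_u^-1
    = h fixes 0, w carries g_u^-1 0 to g_v^-1 0, which no set [Y] as in the test permits. *)
Lemma orbit_check_sound S u v wsc tab D gu gv pu pv tag sw Y :
  {in S, forall s, SLZ s} ->
  orbit_check [seq mxl s | s <- S] (mxl u) (mxl v) wsc tab D gu gv pu pv tag sw Y ->
  exists ws, [/\ wsc = map (@encw m) ws, S = [seq wval w | w <- ws] &
    if tag == 0 then is_word S (word_mx ws sw) /\ act (word_val (word_mx ws sw)) u = v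
    else ~ exists g, generated S g /\ act g u = v].
Proof.
move=> Ssl /and5P[/common_checkP[ws [-> Sws tabD fix0]] /alphabetP[{}gu ->] /alphabetP[{}gv ->]].
move=> /vecokP uE /andP[/vecokP vE H]; exists ws; split=> //.
have gU := generated_unit Ssl.
have conj h : generated S h -> act h u = v ->
    act (invmx (wval gv) *m h *m wval gu)%R (axis m pu.1 pu.2) = axis m pv.1 pv.2.
  by move=> Hh hu; rewrite !act_mul -uE hu; apply: act_inv (val_unit _) (esym vE).
have conjU h : generated S h -> (invmx (wval gv) *m h *m wval gu)%R \in unitmx.
  by move=> /gU hU; rewrite !unitmx_mul unitmx_inv !val_unit hU.
case: eqP H => [_|_].
  rewrite size_map expand_encw -encw_cat !evalc_encw.
  move=> /and3P[ok /eqP pE /first_columnP col]; split; first by rewrite Sws; apply: valid_is_word.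
  by rewrite word_val_mx uE -act_mul -val_cat vE -pE; apply: act_first_column.
case: eqP => [_ /negP ne [h [Hh hu]]|_ /and4P[/eqP pE y0 /allP closed z0] [h [Hh hu]]].
  by apply: ne; apply/eqP; apply: axis_orbit (conjU h Hh) (conj h Hh hu).
have := conj h Hh hu; rewrite -pE => /(stab_codes_word (conjU h Hh))[w wP wE].
have D0 : 0 \in D by case/and3P: tabD.
case/negP: z0; rewrite winvc_encw; rewrite winvc_encw in y0.
suff <- : pact tab (encw w) (pact tab (encw (winv gu)) 0) = pact tab (encw (winv gv)) 0.
  elim: w wP {wE} => //= a w IHw /andP[/closed/allP aP /IHw yY]; exact: aP.
have e0 : pact tab (encw (gv ++ w ++ winv gu)) 0 = 0.
  apply: (generated_fix tabD fix0); rewrite -Sws !val_cat wE val_winv.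
  by rewrite !mulmxA mulmxV ?val_unit // mul1mx mulmxK ?val_unit.
transitivity (pact tab (encw (winv gv)) (pact tab (encw (gv ++ w ++ winv gu)) 0)); last by rewrite e0.
rewrite -!pact_cat -!encw_cat; apply: (tabok_eqv tabD _ D0); apply: presentation.
by rewrite [in RHS]catA [RHS]val_cat (val_cat (winv gv)) val_winvl mul1mx.
Qed.

Lemma orbit_check_complete S u v : {in S, forall s, SLZ s} -> finite_index S ->
  exists wsc tab D gu gv pu pv tag sw Y,
  orbit_check [seq mxl s | s <- S] (mxl u) (mxl v) wsc tab D gu gv pu pv tag sw Y.
Proof.
move=> Ssl Sind.
have [ws [tab [D [ci [Sws com pactE inD [ci1 ciH ciP]]]]]] := common_check_exists Ssl Sind.
have gU := generated_unit Ssl.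
have [gu [p [q uok]]] := vecok_exists u; have /vecokP uE := uok.
have mk (gv : word) pv tag sw Y : vecok m (mxl v) (encw gv) pv.1 pv.2 ->
   (if tag == 0 then
        [&& valid_word (size (map (@encw m) ws)) sw, (p, q) == pv &
            first_column (evalc m (expand (map (@encw m) ws) sw ++ encw gu)) ==
            first_column (evalc m (encw gv))]
      else if tag == 1 then p * pv.2.+1 != pv.1 * q.+1
      else
        [&& (p, q) == pv, pact tab (winvc (encw gu)) 0 \in Y,
            all (fun c => all (fun y => lookup tab c y \in Y) Y) (stab_codes m p) &
            pact tab (winvc (encw gv)) 0 \notin Y]) ->
   exists wsc tab D gu gv pu pv tag sw Y,
     orbit_check [seq mxl s | s <- S] (mxl u) (mxl v) wsc tab D gu gv pu pv tag sw Y.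
  move=> vok H; exists (map (@encw m) ws), tab, D, (encw gu), (encw gv), (p, q), pv, tag, sw, Y.
  by rewrite /orbit_check com !all_alphabet uok vok H.
have [[h [Hh hu]]|no] := boolp.pselect (exists h, generated S h /\ act h u = v).
  rewrite Sws in Hh; have [sw swok swE] := generated_valid Hh.
  (* The word of [v] is taken to be h times that of [u]; then the factors and the first columns
     agree literally. *)
  apply: (mk (expand_word ws sw ++ gu) (p, q) 0 sw [::]).
    by apply/vecokP; rewrite val_cat act_mul -uE swE hu.
  by rewrite size_map swok expand_encw -encw_cat !eqxx.
have [gv [p' [q' vok]]] := vecok_exists v; have /vecokP vE := vok.
case: (eqVneq (p * q'.+1) (p' * q.+1)) => [eq_len|ne]; last first.
  exact: (mk gv (p', q') 1 [::] [::]).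
(* The test compares pairs and not fractions; since the fractions are equal, the pair of [u] can be
   used for [v]. *)
have axE : axis m p' q' = axis m p q.
  rewrite /axis; congr (_ *: _)%R; apply/eqP; rewrite eqr_div ?pnatr_eq0 //.
  by rewrite -!natrM eqr_nat eq_sym eq_len.
rewrite axE in vE.
pose y0 := pact tab (encw (winv gu)) 0.
have ciw w : pact tab (encw w) 0 = ci (wval w).
  by rewrite -{1}ci1 pactE ?unitmx1 // mulmx1.
have inDw w : pact tab (encw w) 0 \in D by rewrite ciw inD ?val_unit.
pose inY x := boolp.asbool (exists2 w : word, all (mem (stab_codes m p)) (encw w) & x = pact tab (encw w) y0).
have inYP x : reflect (exists2 w : word, all (mem (stab_codes m p)) (encw w) & x = pact tab (encw w) y0)
   (inY x) by apply: boolp.asboolP.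
apply: (mk gv (p, q) 2 [::] [seq x <- D | inY x]); first exact/vecokP.
have /and4P[_ _ /and3P[_ /allP Dcl _] _] := com.
rewrite !winvc_encw; apply/and4P; split; first exact: eqxx.
- by rewrite mem_filter inDw andbT; apply/inYP; exists [::].
- apply/allP => c cP; apply/allP => x; rewrite !mem_filter => /andP[/inYP[w wP ->] xD].
  have cA : c \in alphabet m.
    move: cP; rewrite /stab_codes; case: ifP => // _ /mapP[a _ ->]; exact: mem_alphabet.
  rewrite (allP (Dcl c cA)) // andbT; apply/inYP.
  have /mapP[a _ cE] := cA; exists (a :: w); last by rewrite cE.
  by rewrite /= -cE cP.
- rewrite mem_filter negb_and; apply/orP; left; apply/inYP => -[w wP].
  rewrite -pact_cat -encw_cat !ciw => /ciP[]; rewrite ?val_unit // => h Hh hE.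
  apply: no; exists h; split=> //.
  have -> : h = (wval gv *m (wval w *m wval (winv gu)))%R.
    by rewrite -val_cat hE mulmxA val_winvr mul1mx.
  rewrite !act_mul val_winv (act_inv (val_unit gu) (esym uE)).
  by rewrite (stab_codes_act _ wP) vE.
Qed.

(** Reading a stabilizer word w from the right, one finds g w g^-1 = (g t g^-1) k with t in the
    transversal and k in the group generated by [W]. If the left side lies in H, so does g t g^-1;
    then t is empty, because any other t is certified to move 0. *)
Lemma stab_check_sound S u wsc tab D g pu ts W :
  {in S, forall s, SLZ s} ->
  stab_check [seq mxl s | s <- S] (mxl u) wsc tab D g pu ts W ->
  exists ws, [/\ wsc = map (@encw m) ws, S = [seq wval w | w <- ws],
    {in [seq word_mx ws sw | sw <- W], forall s, is_word S s} &
    forall h, generated [seq word_val s | s <- [seq word_mx ws sw | sw <- W]] h <-> stab S u h].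
Proof.
move=> Ssl /and5P[/common_checkP[ws [-> Sws tabD fix0]] /alphabetP[{}g ->] /vecokP uE].
rewrite size_map => /allP Wok /andP[nil_ts /and4P[/allP tsP /allP step /allP Wcol /allP nontriv]].
exists ws; split=> // [_ /mapP[sw /Wok swok ->]|h]; first by rewrite Sws; apply: valid_is_word.
have gU := generated_unit Ssl.
set G := generated _.
have WH sw : sw \in W -> G (wval (expand_word ws sw)).
  move=> swW; apply: GenMem; rewrite -map_comp; apply/mapP; exists sw => //=.
  by rewrite word_val_mx.
have Wstab sw : sw \in W -> stab S u (wval (expand_word ws sw)).
  move=> swW; split; first by rewrite Sws; apply: valid_generated; apply: Wok.
  have := Wcol sw swW; rewrite expand_encw -encw_cat !evalc_encw {}uE.
  move=> /orP[/eqP->|/first_columnP col]; first by rewrite axis0 /act !mulmx0.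
  by rewrite -act_mul -val_cat; apply: act_first_column.
have Gstab k : G k -> stab S u k.
  elim=> {k} [|k|k l _ [Hk ku] _ [Hl lu]|k _ [Hk ku]].
  - by split; [apply: Gen1 | apply: act_one].
  - by rewrite -map_comp => /mapP[sw swW ->]; rewrite /= word_val_mx; apply: Wstab.
  - by split; [apply: GenMul | rewrite act_mul lu].
  - by split; [apply: GenInv | apply: act_inv ku; apply: gU].
split=> [/Gstab//|[Hh hu]].
have [||w wP wE] := @stab_codes_word m pu.1 pu.2 (invmx (wval g) *m h *m wval g)%R.
- by rewrite !unitmx_mul unitmx_inv !val_unit gU.
- by rewrite !act_mul -uE hu; apply: act_inv (val_unit _) (esym uE).
have conjM (x y : word) : wval (g ++ (x ++ y) ++ winv g) =
    (wval (g ++ x ++ winv g) *m wval (g ++ y ++ winv g))%R.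
  by rewrite !val_cat -!mulmxA (mulmxA (wval (winv g))) val_winvl mul1mx.
have [t [k [tts Gk E1]]] : exists t k, [/\ encw t \in ts, G k &
    wval (g ++ w ++ winv g) = (wval (g ++ t ++ winv g) *m k)%R].
  elim: w wP {wE} => [_|a w IHw] /=.
    by exists [::], 1%:M%R; split; [exact: nil_ts | exact: Gen1 | rewrite mulmx1].
  move=> /andP[aP /IHw[t [k [tts Gk E1]]]].
  have := allP (step _ tts) _ aP => /hasP[t' t'ts /hasP[sw swW]].
  have [t1 t'E] : exists t1, t' = encw t1.
    apply: alphabetP; apply: sub_all (tsP _ t'ts) => c; rewrite /stab_codes.
    by case: ifP => // _ /mapP[b _ ->]; apply: mem_alphabet.
  rewrite t'E !winvc_encw -[encl a :: _]/(encw (a :: t) ++ encw (winv g)) -!encw_cat expand_encw !evalc_encw.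
  move=> /eqP/mxl_inj E2; exists t1, (wval (expand_word ws sw) *m k)%R; split.
  - by rewrite -t'E.
  - by apply: GenMul => //; apply: WH.
  - rewrite -[g ++ _]/(g ++ ([:: a] ++ w) ++ winv g) conjM E1 !mulmxA -E2.
    congr (_ *m _)%R; rewrite -conjM -(cat1s a t) !val_cat !val_winv !mulmxA.
    by rewrite mulmxKV ?val_unit // mulmxK ?val_unit.
have hE : h = wval (g ++ w ++ winv g).
  rewrite !val_cat wE val_winv !mulmxA mulmxV ?val_unit // mul1mx.
  by rewrite mulmxK ?val_unit.
have t0 : t = [::].
  have := nontriv _ tts; rewrite winvc_encw -!encw_cat (generated_fix tabD fix0) ?orbF.
    by case: (t).
  rewrite -Sws; suff -> : wval (g ++ t ++ winv g) = (h *m invmx k)%R.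
    by apply: GenMul => //; apply: GenInv; case: (Gstab k Gk).
  by rewrite hE E1 mulmxK //; apply: gU; case: (Gstab k Gk).
suff -> : h = k by [].
by rewrite hE E1 t0 val_cat val_winvr mul1mx.
Qed.

(** The transversal has a word t_x for each point x in the orbit of g^-1 0. For a letter c and x' =
    c x, the Schreier generator g t_x'^-1 c t_x g^-1 lies in H, because t_x' and c t_x both carry
    g^-1 0 to x'. *)
Lemma stab_check_complete S u : {in S, forall s, SLZ s} -> finite_index S ->
  exists wsc tab D g pu ts W,
  stab_check [seq mxl s | s <- S] (mxl u) wsc tab D g pu ts W.
Proof.
move=> Ssl Sind.
have [ws [tab [D [ci [Sws com pactE inD [ci1 ciH ciP]]]]]] := common_check_exists Ssl Sind.
have [g [p [q uok]]] := vecok_exists u; have /vecokP uE := uok.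
pose y0 := pact tab (encw (winv g)) 0.
have ciw w : pact tab (encw w) 0 = ci (wval w).
  by rewrite -{1}ci1 pactE ?unitmx1 // mulmx1.
have inDw w : pact tab (encw w) 0 \in D by rewrite ciw inD ?val_unit.
pose P (w : word) := all (mem (stab_codes m p)) (encw w).
pose reach x := exists2 w, P w & pact tab (encw w) y0 = x.
have /boolp.choice[f fP] : forall x, exists w : word, reach x -> P w /\ pact tab (encw w) y0 = x.
  move=> x; have [[w wP wx]|no] := boolp.pselect (reach x); first by exists w.
  by exists [::] => /no.
(* The base point must get the empty word, because [stab_check] demands that every other member of
   [ts] moves 0. *)
pose tw x := if x == y0 then [::] else f x.
have twP x : reach x -> P (tw x) /\ pact tab (encw (tw x)) y0 = x.
  by move=> rx; rewrite /tw; case: eqP => [->|_]; [split | apply: fP].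
have reachD x : reach x -> x \in D.
  by move=> [w _ <-]; rewrite -pact_cat -encw_cat.
pose Y := [seq x <- D | boolp.asbool (reach x)].
have YP x : x \in Y -> reach x by rewrite mem_filter => /andP[/boolp.asboolP].
have inY x : reach x -> x \in Y.
  by move=> rx; rewrite mem_filter reachD // andbT; apply/boolp.asboolP.
pose ts := [seq encw (tw x) | x <- Y].
pose R (k : nat * lcode) sw := valid_word (size ws) sw /\ exists2 x', x' \in Y &
   evalc m (encw g ++ winvc (encw (tw x')) ++ k.2 :: encw (tw k.1) ++ winvc (encw g)) =
   evalc m (expand (map (@encw m) ws) sw).
have codeP c : c \in stab_codes m p -> exists2 a, c = encl a & P [:: a].
  move=> cP; have /mapP[a _ ca] : c \in alphabet m.
    move: cP; rewrite /stab_codes; case: ifP => // _ /mapP[a _ ->]; exact: mem_alphabet.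
  by exists a; rewrite // /P /= -ca cP.
(* Both clauses of [list_choice] matter: all Schreier generators occur in [W], and nothing else
   does, since every member has to fix [u]. *)
have [|W [Wall Wok]] := @list_choice _ _ R [seq (x, c) | x <- Y, c <- stab_codes m p].
  move=> _ /allpairsP[[x c] [/= /YP rx /codeP[a -> aP] ->]].
  have [xP xE] := twP x rx.
  have rx' : reach (pact tab (encw (a :: tw x)) y0).
    by exists (a :: tw x) => //; move: aP; rewrite /P /= andbT => ->.
  set x' := pact _ _ _ in rx'; have [x'P x'E] := twP x' rx'.
  have : ci (wval (tw x' ++ winv g)) = ci (wval (a :: tw x ++ winv g)).
    rewrite -!ciw -[encw (a :: _ ++ _)]/(encw ((a :: tw x) ++ winv g)) !encw_cat !pact_cat.
    exact: x'E.
  move=> /ciP[]; rewrite ?val_unit // => h Hh hE.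
  rewrite Sws in Hh; have [sw swok swE] := generated_valid Hh.
  exists sw; split=> //; exists x'; first exact: inY.
  rewrite /= !winvc_encw -[encl a :: _]/(encw (a :: tw x) ++ _) -!encw_cat expand_encw.
  rewrite !evalc_encw; congr mxl; rewrite swE.
  have -> : h = (wval (winv (tw x' ++ winv g)) *m wval (a :: tw x ++ winv g))%R.
    by rewrite hE mulmxA val_winvl mul1mx.
  by rewrite -val_cat winv_cat winvK -catA.
have Wvalid sw : sw \in W -> valid_word (size ws) sw by move=> /Wok[k _ []].
exists (map (@encw m) ws), tab, D, (encw g), (p, q), ts, W.
apply/and5P; split=> //; first exact: all_alphabet.
  by rewrite size_map; apply/allP.
have ry0 : reach y0 by exists [::].
apply/andP; split.
  by apply/mapP; exists y0; [exact: inY | rewrite /tw eqxx].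
apply/and4P; split.
- by apply/allP => _ /mapP[x /YP/twP[xP _] ->].
- apply/allP => _ /mapP[x xY ->]; apply/allP => c cP.
  have [|sw swW [swok [x' x'Y /= e]]] := Wall (x, c); first by apply/allpairsP; exists (x, c).
  apply/hasP; exists (encw (tw x')); first exact: map_f.
  by apply/hasP; exists sw => //; rewrite e.
- apply/allP => sw swW; rewrite /=; case: (eqVneq p 0) => //= p0.
  have [_ /allpairsP[[x c] [/= /YP rx cP ->]] [swok [x' /YP rx' /=]]] := Wok sw swW.
  have [a ca aP] := codeP c cP; rewrite {}ca {cP}.
  rewrite !winvc_encw -[encl a :: _]/(encw (a :: tw x) ++ _) -!encw_cat expand_encw.
  rewrite -encw_cat !evalc_encw => /mxl_inj swE; apply/first_columnP.
  apply: (first_column_act p0 (q := q)).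
  have [xP _] := twP x rx; have [x'P _] := twP x' rx'.
  have Pax (w : word) : P w -> act (wval w) (axis m p q) = axis m p q by apply: stab_codes_act.
  have atP : P (a :: tw x) by move: aP; rewrite /P /= andbT => ->.
  rewrite val_cat -swE !val_cat !act_mul !val_winv.
  rewrite (act_inv (val_unit g) (erefl _)) Pax //.
  by rewrite (act_inv (val_unit _) (Pax _ x'P)).
- apply/allP => _ /mapP[x /YP rx ->]; rewrite /tw; case: (eqVneq x y0) => [//|xy].
  apply/orP; right; apply: contraNneq xy; have [xP xE] := fP x rx.
  rewrite winvc_encw -!encw_cat => e; apply/eqP.
  have /and4P[_ _ tabD _] := com.
  have D0 : 0 \in D by case/and3P: tabD.
  transitivity (pact tab (encw (winv g)) (pact tab (encw (g ++ f x ++ winv g)) 0)); last by rewrite e.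
  rewrite -{1}xE -!pact_cat -!encw_cat; apply: (tabok_eqv tabD _ D0); apply: presentation.
  by rewrite [in RHS]catA [RHS]val_cat (val_cat (winv g)) val_winvl mul1mx.
Qed.

End Decision.

(** * Computability of the tests *)

Ltac comp_auto := comp_core; repeat (lazymatch goal with
  | |- computable (fun x => cons _ _) => apply: computable_cons
  | |- computable (fun x => rev _) => apply: computable_rev
  | |- computable (fun x => map _ _) => apply: computable_map
  | |- computable (fun x => all _ _) => apply: computable_all
  | |- computable (fun x => has _ _) => apply: computable_has
  | |- computable (fun x => foldr _ _ _) => apply: computable_foldr
  | |- computable (fun x => in_mem _ (mem _)) => apply: computable_mem
  | |- computable (fun x => cat _ _) => apply: computable_cat
  | |- computable (fun x => flatten _) => apply: computable_flatten
  | |- computable (fun x => size _) => apply: computable_size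
  | |- computable (fun x => nth _ _ _) => apply: computable_nth
  | |- computable (fun x => Posz _) => apply: computable_Posz
  | |- computable (fun x => (_ + _)%R) => apply: computable_addz
  | |- computable (fun x => (- _)%R) => apply: computable_opp
  | |- computable (fun x => (_ * _)%R) => apply: computable_mulz
  | |- computable (fun x => numq _) => apply: computable_numq
  | |- computable (fun x => denq _) => apply: computable_denq
  | H : computable ?f |- computable (fun x => ?f (@?g x)) => apply (computable_comp H)
  end; comp_core).

Lemma computable_linvc (A : encType) (c : A -> lcode) :
  computable c -> computable (fun x => linvc (c x)).
Proof. by move=> cc; rewrite /linvc; comp_auto. Qed.

Lemma computable_winvc (A : encType) (w : A -> seq lcode) :
  computable w -> computable (fun x => winvc (w x)).
Proof.
move=> cw; rewrite /winvc; apply: computable_rev; apply: computable_map => //.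
apply: computable_linvc; comp_auto.
Qed.

Lemma computable_lookup (A : encType) (tab : A -> table) (c : A -> lcode) (y : A -> nat) :
  computable tab -> computable c -> computable y ->
  computable (fun x => lookup (tab x) (c x) (y x)).
Proof. move=> ct cc cy; rewrite /lookup; comp_auto. Qed.

Lemma computable_pact (A : encType) (tab : A -> table) (w : A -> seq lcode) (y : A -> nat) :
  computable tab -> computable w -> computable y ->
  computable (fun x => pact (tab x) (w x) (y x)).
Proof.
move=> ct cw cy; apply: computable_foldr => //.
apply: computable_lookup; comp_auto.
Qed.

Lemma computable_sletter (A : encType) (ws : A -> seq (seq lcode)) (kb : A -> nat * nat) :
  computable ws -> computable kb -> computable (fun x => sletter (ws x) (kb x)).
Proof.
move=> cw ck; rewrite /sletter; comp_auto.
apply: computable_winvc; comp_auto.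
Qed.

Lemma computable_expand (A : encType) (ws : A -> seq (seq lcode)) (sw : A -> seq (nat * nat)) :
  computable ws -> computable sw -> computable (fun x => expand (ws x) (sw x)).
Proof.
move=> cw cs; apply: computable_flatten; apply: computable_map => //.
apply: computable_sletter; comp_auto.
Qed.

Lemma computable_entry (A : encType) (f : A -> seq (seq int)) (i j : A -> nat) :
  computable f -> computable i -> computable j ->
  computable (fun x => entry (f x) (i x) (j x)).
Proof. move=> cf ci cj; rewrite /entry; comp_auto. Qed.

Lemma computable_lactc m (A : encType) (c : A -> lcode) (f : A -> seq (seq int)) :
  computable c -> computable f -> computable (fun x => lactc m (c x) (f x)).
Proof.
move=> cc cf; rewrite /lactc /mklist.
have ce (B : encType) (g : B -> seq (seq int)) (i j : B -> nat) :=
  @computable_entry B g i j.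
comp_auto; apply: ce; comp_auto.
Qed.

Lemma computable_evalc m (A : encType) (w : A -> seq lcode) :
  computable w -> computable (fun x => evalc m (w x)).
Proof.
move=> cw; apply: computable_foldr => //; last exact: computable_cst.
apply: computable_lactc; comp_auto.
Qed.

Lemma computable_sub_all (A B : encType) (l s : A -> seq B) :
  computable l -> computable s -> computable (fun x => all (mem (s x)) (l x)).
Proof.
move=> cl cs; apply: (@computable_ext _ _ (fun x => all (fun y => y \in s x) (l x))) => //.
comp_auto.
Qed.

Lemma computable_first_column (A : encType) (f : A -> seq (seq int)) :
  computable f -> computable (fun x => first_column (f x)).
Proof. move=> cf; rewrite /first_column; comp_auto. Qed.

Lemma computable_valid_word (A : encType) (p : A -> nat) (sw : A -> seq (nat * nat)) :
  computable p -> computable sw -> computable (fun x => valid_word (p x) (sw x)).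
Proof. move=> cp cs; rewrite /valid_word; comp_auto. Qed.

Lemma computable_stab_codes m (A : encType) (p : A -> nat) :
  computable p -> computable (fun x => stab_codes m (p x)).
Proof. move=> cp; rewrite /stab_codes; comp_auto. Qed.

Ltac comp_calls := comp_auto; repeat (lazymatch goal with
  | |- computable (fun x => winvc _) => apply: computable_winvc
  | |- computable (fun x => lookup _ _ _) => apply: computable_lookup
  | |- computable (fun x => pact _ _ _) => apply: computable_pact
  | |- computable (fun x => sletter _ _) => apply: computable_sletter
  | |- computable (fun x => expand _ _) => apply: computable_expand
  | |- computable (fun x => entry _ _ _) => apply: computable_entry
  | |- computable (fun x => evalc _ _) => apply: computable_evalc
  | |- computable (fun x => first_column _) => apply: computable_first_column
  | |- computable (fun x => valid_word _ _) => apply: computable_valid_word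
  | |- computable (fun x => stab_codes _ _) => apply: computable_stab_codes
  end; comp_auto).

Lemma computable_vecok m (A : encType) (v : A -> seq (seq rat)) (g : A -> seq lcode)
    (p q : A -> nat) :
  computable v -> computable g -> computable p -> computable q ->
  computable (fun x => vecok m (v x) (g x) (p x) (q x)).
Proof. move=> cv cg cp cq; rewrite /vecok /rat_at; comp_calls. Qed.

Lemma computable_common_check m (A : encType) (S : A -> seq (seq (seq int)))
    (ws : A -> seq (seq lcode)) (tab : A -> table) (D : A -> seq nat) :
  computable S -> computable ws -> computable tab -> computable D ->
  computable (fun x => common_check m (S x) (ws x) (tab x) (D x)).
Proof.
move=> cS cw ct cD; rewrite /common_check; apply: computable_and.
  by apply: computable_all => //; apply: computable_sub_all; comp_auto.
by rewrite /tabok; comp_calls.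
Qed.

(** * Certificate types and the two programs *)

Definition common_cert : encType := (seq (seq lcode) * (seq (lcode * nat * nat) * seq nat))%type.
Definition orbit_cert : encType :=
  (common_cert * ((seq lcode * seq lcode) * (((nat * nat) * (nat * nat)) *
    (nat * (seq (nat * nat) * seq nat)))))%type.
Definition stab_cert : encType :=
  (common_cert * (seq lcode * ((nat * nat) * (seq (seq lcode) * seq (seq (nat * nat))))))%type.

Definition orbit_test m (x : seq (seq (seq int)) * (seq (seq rat) * seq (seq rat)))
    (c : orbit_cert) : bool :=
  orbit_check m x.1 x.2.1 x.2.2 c.1.1 c.1.2.1 c.1.2.2 c.2.1.1 c.2.1.2 c.2.2.1.1 c.2.2.1.2
    c.2.2.2.1 c.2.2.2.2.1 c.2.2.2.2.2.

Definition stab_test m (x : seq (seq (seq int)) * seq (seq rat)) (c : stab_cert) : bool :=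
  stab_check m x.1 x.2 c.1.1 c.1.2.1 c.1.2.2 c.2.1 c.2.2.1 c.2.2.2.1 c.2.2.2.2.

Lemma computable_orbit_test m :
  computable (fun q : _ * orbit_cert => orbit_test m q.1 q.2).
Proof.
rewrite /orbit_test /orbit_check; apply: computable_and.
  by apply: computable_common_check; comp_auto.
apply: computable_and; first by apply: computable_sub_all; comp_auto.
apply: computable_and; first by apply: computable_sub_all; comp_auto.
apply: computable_and; first by apply: computable_vecok; comp_auto.
apply: computable_and; first by apply: computable_vecok; comp_auto.
comp_calls.
Qed.

Lemma computable_stab_test m :
  computable (fun q : _ * stab_cert => stab_test m q.1 q.2).
Proof.
rewrite /stab_test /stab_check; apply: computable_and.
  by apply: computable_common_check; comp_auto.
apply: computable_and; first by apply: computable_sub_all; comp_auto.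
apply: computable_and; first by apply: computable_vecok; comp_auto.
apply: computable_and; first by comp_calls.
apply: computable_and; first by comp_calls.
apply: computable_and; last by comp_calls.
apply: computable_all; last by comp_auto.
by apply: computable_sub_all; comp_calls.
Qed.

Lemma surjective_common_cert : surjective_code common_cert.
Proof.
do ?[apply: surjective_code_pair | apply: surjective_code_seq]; exact: surjective_code_nat.
Qed.

Lemma surjective_orbit_cert : surjective_code orbit_cert.
Proof.
apply: surjective_code_pair; first exact: surjective_common_cert.
do ?[apply: surjective_code_pair | apply: surjective_code_seq]; exact: surjective_code_nat.
Qed.

Lemma surjective_stab_cert : surjective_code stab_cert.
Proof.
apply: surjective_code_pair; first exact: surjective_common_cert.
do ?[apply: surjective_code_pair | apply: surjective_code_seq]; exact: surjective_code_nat.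
Qed.

(** A certificate names generators by position, whereas the answer has to list matrices. *)
Definition word_output m (ws : seq (seq lcode)) (sw : seq (nat * nat)) : seq (seq (seq int)) :=
  [seq evalc m (sletter ws kb) | kb <- sw].

Lemma computable_word_output m (A : encType) (ws : A -> seq (seq lcode))
    (sw : A -> seq (nat * nat)) :
  computable ws -> computable sw -> computable (fun x => word_output m (ws x) (sw x)).
Proof. move=> cw cs; rewrite /word_output; comp_calls. Qed.

Lemma word_outputE m (ws : seq (seq (letter m.+1))) sw :
  word_output m (map (@encw m) ws) sw = [seq mxl g | g <- word_mx ws sw].
Proof.
rewrite /word_output /word_mx -map_comp; apply: eq_map => kb /=.
by rewrite sletter_encw evalc_encw.
Qed.

Lemma enc_seq_map (T U : Type) (e : U -> nat) (f : T -> U) s :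
  enc_seq e [seq f x | x <- s] = enc_seq (fun x => e (f x)) s.
Proof. by elim: s => //= x s ->. Qed.

Lemma search_output (A C B : encType) (chk : A -> C -> bool) (f : C -> B) :
  surjective_code C -> computable (fun q : A * C => chk q.1 q.2) -> computable f ->
  exists p, forall x, (exists c, chk x c) ->
    exists2 c, chk x c & eval p (code x) (code (f c)).
Proof.
move=> sC /(certificate_search sC)[p Hp] [r Hr]; exists (Comp r p) => x /Hp[c [cx pc]].
by exists c => //; apply: EvalComp pc (Hr c).
Qed.

Theorem mainTheorem3 (n : nat) (n_ge3 : (3 <= n)%N) :
  (exists orbit_prog : prog,
     forall (S : seq 'M[int]_n) (u v : 'cV[rat]_n),
       {in S, forall s, SLZ s} -> finite_index S ->
       exists out : option (seq 'M[int]_n),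
         eval orbit_prog
           (cpair (enc_seq (enc_mx enc_int) S) (cpair (enc_vec u) (enc_vec v)))
           (enc_option enc_word out)
         /\ match out with
            | Some w => is_word S w /\ act (word_val w) u = v
            | None => ~ exists g, generated S g /\ act g u = v
            end)
  /\
  (exists stab_prog : prog,
     forall (S : seq 'M[int]_n) (u : 'cV[rat]_n),
       {in S, forall s, SLZ s} -> finite_index S ->
       exists out : seq (seq 'M[int]_n),
         eval stab_prog
           (cpair (enc_seq (enc_mx enc_int) S) (enc_vec u))
           (enc_seq enc_word out)
         /\ {in out, forall w, is_word S w}
         /\ (forall g, generated [seq word_val w | w <- out] g <-> stab S u g)).
Proof.
case: n n_ge3 => // m _.
have inputE (S : seq 'M[int]_m.+1) : enc_seq (enc_mx enc_int) S = code [seq mxl s | s <- S].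
  by rewrite [RHS]enc_seq_map.
have wordE (w : seq 'M[int]_m.+1) : enc_word w = code [seq mxl g | g <- w].
  exact: inputE.
split.
  have [|p Hp] := @search_output _ _ _ (orbit_test m)
    (fun c => if c.2.2.2.1 == 0 then Some (word_output m c.1.1 c.2.2.2.2.1) else None)
    surjective_orbit_cert (computable_orbit_test m).
    apply: computable_if; [by comp_auto | | exact: computable_cst].
    by apply: computable_Some; apply: computable_word_output; comp_auto.
  exists p => S u v Ssl Sind.
  have [|c chk_c] := Hp ([seq mxl s | s <- S], (mxl u, mxl v)).
    have [ws [tab [D [gu [gv [pu [pv [tag [sw [Y H]]]]]]]]]] := orbit_check_complete u v Ssl Sind.
    by exists ((ws, (tab, D)), ((gu, gv), ((pu, pv), (tag, (sw, Y))))).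
  have [ws [wsE Sws H]] := orbit_check_sound Ssl chk_c.
  rewrite wsE word_outputE => ev.
  exists (if c.2.2.2.1 == 0 then Some (word_mx ws c.2.2.2.2.1) else None).
  rewrite inputE; case: eqP ev H => _ ev H; split=> //.
  by rewrite /= wordE.
have [|p Hp] := @search_output _ _ _ (stab_test m)
  (fun c => [seq word_output m c.1.1 sw | sw <- c.2.2.2.2])
  surjective_stab_cert (computable_stab_test m).
  apply: computable_map; last by comp_auto.
  by apply: computable_word_output; comp_auto.
exists p => S u Ssl Sind.
have [|c chk_c] := Hp ([seq mxl s | s <- S], mxl u).
  have [ws [tab [D [g [pu [ts [W H]]]]]]] := stab_check_complete u Ssl Sind.
  by exists ((ws, (tab, D)), (g, (pu, (ts, W)))).
have [ws [wsE Sws H1 H2]] := stab_check_sound Ssl chk_c.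
rewrite wsE (eq_map (word_outputE ws)) => ev.
exists [seq word_mx ws sw | sw <- c.2.2.2.2]; split; last by split.
rewrite inputE; move: ev; rewrite [code [seq _ | sw <- _]]enc_seq_map enc_seq_map.
suff -> : enc_seq (fun sw => enc_word (word_mx ws sw)) c.2.2.2.2 =
  enc_seq (fun sw => code [seq mxl g | g <- word_mx ws sw]) c.2.2.2.2 by [].
by elim: (c.2.2.2.2) => //= sw s ->; rewrite wordE.
Qed.
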